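(* Let $\{s_n\}$ be a separated sequence on the real line and let $D>0$ be a constant such that for every integer $N\ge 2$ there are points $t_1<t_2<\dots<t_N$ of the sequence with $[t_1,t_N]\cap\{s_m\}=\{t_n\}_{n=1}^N$, with $t_2-t_1>ND$, and with $t_{n+1}-t_n<D$ for all $2\le n\le N-1$. Let $\Theta$ be a meromorphic inner function on $\mathbb C_+$ with spectrum $\sigma(\Theta)=\{s_n\}$. Then for every $\delta>0$ there is a zero $z=x+iy$ of $\Theta$ such that $0<y<\delta$. Hence $|\Theta'|$ is unbounded on $\mathbb R$.
   Context: $\mathbb C_+$ is the open upper half-plane. An inner function on $\mathbb C_+$ is a bounded analytic function on $\mathbb C_+$ with unit modulus almost everywhere on $\mathbb R$ (boundary values). A meromorphic inner function is an inner function on $\mathbb C_+$ that has a meromorphic continuation to $\mathbb C$. The spectrum of a meromorphic inner function $\Theta$ is the level set $\sigma(\Theta)=\{x\in\mathbb R:\Theta(x)=1\}$. A sequence $\{s_n\}$ is separated if there is $\delta_0>0$ with $|s_n-s_m|>\delta_0$ for all $n\neq m$. *)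

(* Defs.v *)
(* Stdlib reals + Coquelicot. *)
From Stdlib Require Import Reals.
From Coquelicot Require Import Coquelicot.
Open Scope R_scope.

Definition upper_half_plane (z : C) : Prop := 0 < Im z.

(* Lebesgue null sets of the line, via countable covers by open intervals of
   arbitrarily small total length; the lengths are nonnegative, so bounding
   the partial sums bounds the total. *)
Definition null_set (E : R -> Prop) : Prop :=
  forall eps : posreal, exists a b : nat -> R,
    (forall k, a k <= b k) /\
    (forall x, E x -> exists k, a k < x < b k) /\
    (forall n, sum_n (fun k => b k - a k) n <= eps).

Definition almost_everywhere (P : R -> Prop) : Prop :=
  null_set (fun x => ~ P x).

(* Complex differentiability: the scalar field of [ex_derive] is [C]. *)
Definition analytic_on (U : C -> Prop) (f : C -> C) : Prop :=
  forall z, U z -> ex_derive (K := C_AbsRing) f z.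

Definition stolz_angle (alpha x : R) (z : C) : Prop :=
  upper_half_plane z /\ Rabs (Re z - x) <= alpha * Im z.

Definition nontangential_limit (f : C -> C) (x : R) (l : C) : Prop :=
  forall alpha : R, 0 < alpha ->
    filterlim f (within (stolz_angle alpha x) (locally (RtoC x))) (locally l).

(* Only the values of [f] on the open upper half-plane matter. *)
Definition inner_function (f : C -> C) : Prop :=
  analytic_on upper_half_plane f /\
  (exists M : R, forall z, upper_half_plane z -> Cmod (f z) <= M) /\
  almost_everywhere (fun x =>
    exists l : C, nontangential_limit f x l /\ Cmod l = 1).

Definition pole (f : C -> C) (z : C) : Prop :=
  filterlim (fun w => Cmod (f w)) (locally' z) (Rbar_locally p_infty).

(* A meromorphic function is a total function whose value at a pole is
   irrelevant; at every other point it is analytic, so its value there is the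
   true one (no removable singularities are left unfilled). *)
Definition meromorphic (f : C -> C) : Prop :=
  forall z : C,
    locally' z (fun w => ex_derive (K := C_AbsRing) f w) /\
    (ex_derive (K := C_AbsRing) f z \/ pole f z).

(* The inner function is identified with its (unique) meromorphic
   continuation. Being bounded on the upper half-plane, it has no real pole,
   so its values and derivatives on the line are meaningful. *)
Definition meromorphic_inner_function (f : C -> C) : Prop :=
  inner_function f /\ meromorphic f.

Definition spectrum (f : C -> C) (x : R) : Prop := f (RtoC x) = RtoC 1.

Definition separated (s : nat -> R) : Prop :=
  exists delta0 : R, 0 < delta0 /\
    forall n m : nat, n <> m -> Rabs (s n - s m) > delta0.

(* Main.v *)
Require Import Defs.
From Stdlib Require Import Reals ZArith Lra Lia Classical ClassicalEpsilon.
From Coquelicot Require Import Coquelicot.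
Open Scope R_scope.

(** Write Theta = exp(i phi) on the line and u = - ln |Theta| >= 0 above it. By the
    Cauchy-Riemann equations phi' is the normal derivative of u, hence nonnegative,
    and phi increases by exactly 2 pi between consecutive points of the spectrum.

    Suppose that Theta has no zero in 0 < y < delta, and fix a small height h. In
    the strip u is a positive harmonic function vanishing on the line, so Harnack's
    inequality and its boundary versions make phi'(x) comparable with u(x + ih)
    ([speed_le_interior], [speed_ge_interior]), and make the values u(x + ih)
    comparable with each other for nearby x ([harnack_chain]). In the short
    intervals of a block t_2 < ... < t_N the phase turns once within a distance D,
    so phi' >= 1/D somewhere ([short_interval]); hence u(x + ih) >= c_1 for all x
    in [t_2, t_N], with c_1 independent of N.

    Above the height h, where zeros are possible, u is still superharmonic. So it
    dominates c_1 times the harmonic measure of the segment over [t_2, t_N]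
    ([angle_bound]), which at the point t_2 - r + 2ih is at least of order h/r as
    long as r is at most the length of the block. Therefore phi'(t_2 - r) >= c/r
    for h <= r <= R ([speed_beside_block]), where R can be taken arbitrarily large
    by increasing N, because the points are separated and t_2 - t_1 > N D. The
    phase thus gains c ln (R/h) in the gap (t_1, t_2). But it cannot gain more than
    2 pi in an interval without spectrum ([gap_log]), a contradiction.

    If Theta(x + iy) = 0, then |Theta| is at most the modulus of the corresponding
    Blaschke factor ([schwarz_pick]), which forces |Theta'(x)| >= 1/y
    ([speed_ge_inv_height]). So zeros close to the line make Theta' unbounded.

    The comparisons of u with explicit harmonic functions are bounds for the modulus
    of Theta, or of its inverse, times the exponential of an analytic function;
    Harnack's inequality is the Schwarz lemma for a logarithm of Theta
    ([harnack]). All of this rests on the maximum modulus principle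
    ([max_modulus]), and this on Goursat's lemma ([contour_zero]) through the mean
    value property. *)

(** * Complex derivatives *)

Notation is_Cderive := (is_derive (K := C_AbsRing) (V := C_NormedModule)).
Notation ex_Cderive := (ex_derive (K := C_AbsRing) (V := C_NormedModule)).

Lemma is_Cderive_iff (f : C -> C) (z l : C) :
  is_Cderive f z l <->
  forall eps : R, 0 < eps -> exists d : R, 0 < d /\
    forall w : C, Cmod (w - z)%C < d ->
      Cmod (f w - f z - l * (w - z))%C <= eps * Cmod (w - z)%C.
Proof.
  split.
  - intros [_ H] eps Heps.
    specialize (H z (fun P HP => HP) (mkposreal eps Heps)).
    destruct H as [d Hd].
    exists d; split; [apply cond_pos|].
    intros w Hw. specialize (Hd w Hw).
    cbn in Hd. replace (l * (w - z))%C with ((w - z) * l)%C by ring. exact Hd.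
  - intros H. split.
    + apply is_linear_scal_l.
    + intros x Hx eps.
      assert (x = z) as ->.
      { symmetry. apply (is_filter_lim_locally_unique (V := AbsRing_NormedModule C_AbsRing)). exact Hx. }
      destruct (H eps (cond_pos eps)) as [d [Hd Hw]].
      exists (mkposreal d Hd). intros w Hwd.
      specialize (Hw w Hwd). cbn.
      replace ((w + - z) * l)%C with (l * (w - z))%C by ring. exact Hw.
Qed.

(** The product and chain rules speak of functions valued in the ring [C], while
    [is_Cderive] is about functions valued in the normed space [C]; the limit is
    the same. *)
Lemma is_Cderive_ring (f : C -> C) (z l : C) :
  is_derive (K := C_AbsRing) (V := AbsRing_NormedModule C_AbsRing) f z l <->
  is_Cderive f z l.
Proof.
  split; intros [_ H]; (split; [apply is_linear_scal_l | exact H]).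
Qed.

Lemma locally_Cmod (z : C) (P : C -> Prop) :
  locally z P <-> exists d : R, 0 < d /\ forall w : C, Cmod (w - z)%C < d -> P w.
Proof.
  rewrite (locally_C z P). split.
  - intros [d Hd]. exists d; split; [apply cond_pos | exact Hd].
  - intros [d [Hd H]]. exists (mkposreal d Hd). exact H.
Qed.

Lemma Cmod_le_dist (z w : C) : Cmod z <= Cmod w + Cmod (w - z)%C.
Proof.
  pose proof (Cmod_triangle w (z - w)%C) as T.
  replace (w + (z - w))%C with z in T by ring.
  replace (z - w)%C with (- (w - z))%C in T by ring.
  now rewrite Cmod_opp in T.
Qed.

Lemma im_le_Cmod (z : C) : Rabs (Im z) <= Cmod z.
Proof. eapply Rle_trans; [|apply (Rmax_Cmod z)]. apply Rmax_r. Qed.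

Lemma exp_le_compat (x y : R) : x <= y -> exp x <= exp y.
Proof. intros [H| ->]; [left; now apply exp_increasing | apply Rle_refl]. Qed.

Lemma Cmod_vertical (x y y' : R) : Cmod ((x, y) - (x, y'))%C = Rabs (y - y').
Proof.
  replace ((x, y) - (x, y'))%C with (Ci * RtoC (y - y'))%C by (apply injective_projections; cbn; ring).
  rewrite Cmod_mult, Cmod_Ci, Cmod_R. ring.
Qed.

Lemma Cmod_horizontal (x x' y : R) : Cmod ((x, y) - (x', y))%C = Rabs (x - x').
Proof.
  replace ((x, y) - (x', y))%C with (RtoC (x - x'))%C by (apply injective_projections; cbn; ring).
  apply Cmod_R.
Qed.

Lemma ex_Cderive_const (c z : C) : ex_Cderive (fun _ => c) z.
Proof. apply (ex_derive_const (K := C_AbsRing)). Qed.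

Lemma ex_Cderive_id (z : C) : ex_Cderive (fun w => w) z.
Proof.
  exists (RtoC 1). apply is_Cderive_iff. intros eps He. exists 1; split; [lra|].
  intros w _. replace (w - z - 1 * (w - z))%C with (RtoC 0) by ring.
  rewrite Cmod_0. pose proof (Cmod_ge_0 (w - z)%C). nra.
Qed.

Lemma ex_Cderive_plus (f g : C -> C) (z : C) :
  ex_Cderive f z -> ex_Cderive g z -> ex_Cderive (fun w => f w + g w)%C z.
Proof. exact (@ex_derive_plus C_AbsRing C_NormedModule f g z). Qed.

Lemma ex_Cderive_opp (f : C -> C) (z : C) :
  ex_Cderive f z -> ex_Cderive (fun w => - f w)%C z.
Proof. exact (@ex_derive_opp C_AbsRing C_NormedModule f z). Qed.

Lemma ex_Cderive_minus (f g : C -> C) (z : C) :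
  ex_Cderive f z -> ex_Cderive g z -> ex_Cderive (fun w => f w - g w)%C z.
Proof. exact (@ex_derive_minus C_AbsRing C_NormedModule f g z). Qed.

Lemma ex_Cderive_plus_const (c z : C) : ex_Cderive (fun w => w + c)%C z.
Proof. apply ex_Cderive_plus; [apply ex_Cderive_id | apply ex_Cderive_const]. Qed.

Lemma ex_Cderive_minus_const (c z : C) : ex_Cderive (fun w => w - c)%C z.
Proof. apply ex_Cderive_minus; [apply ex_Cderive_id | apply ex_Cderive_const]. Qed.

Lemma ex_Cderive_mult (f g : C -> C) (z : C) :
  ex_Cderive f z -> ex_Cderive g z -> ex_Cderive (fun w => f w * g w)%C z.
Proof.
  intros [l Hl] [m Hm]. eexists. apply is_Cderive_ring.
  apply (is_derive_mult (K := C_AbsRing));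
    [apply is_Cderive_ring; exact Hl | apply is_Cderive_ring; exact Hm |].
  intros; apply Cmult_comm.
Qed.

Lemma ex_Cderive_comp (f g : C -> C) (z : C) :
  ex_Cderive f (g z) -> ex_Cderive g z -> ex_Cderive (fun w => f (g w)) z.
Proof.
  intros [l Hl] [m Hm]. eexists.
  apply (is_derive_comp (K := C_AbsRing) (V := C_NormedModule)); [exact Hl |].
  apply is_Cderive_ring; exact Hm.
Qed.

Lemma ex_Cderive_pow (f : C -> C) (n : nat) (z : C) :
  ex_Cderive f z -> ex_Cderive (fun w => Cpow (f w) n) z.
Proof.
  intros Hf. induction n as [|n IH]; cbn.
  - apply ex_Cderive_const.
  - now apply ex_Cderive_mult.
Qed.

Lemma ex_Cderive_continuous (f : C -> C) (z : C) :
  ex_Cderive f z -> forall eps : R, 0 < eps ->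
  locally z (fun w => Cmod (f w - f z)%C < eps).
Proof.
  intros [l Hl] eps He.
  destruct (proj1 (is_Cderive_iff f z l) Hl 1 Rlt_0_1) as [d [Hd H]].
  apply locally_Cmod.
  pose proof (Cmod_ge_0 l).
  exists (Rmin d (eps / (Cmod l + 2))).
  assert (0 < eps / (Cmod l + 2)) as Hq by (apply Rdiv_lt_0_compat; lra).
  split; [now apply Rmin_pos|].
  intros w Hw.
  assert (Cmod (w - z)%C < d) as H1 by (eapply Rlt_le_trans; [exact Hw | apply Rmin_l]).
  assert (Cmod (w - z)%C < eps / (Cmod l + 2)) as H2 by (eapply Rlt_le_trans; [exact Hw | apply Rmin_r]).
  specialize (H w H1).
  replace (f w - f z)%C with ((f w - f z - l * (w - z)) + l * (w - z))%C by ring.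
  eapply Rle_lt_trans; [apply Cmod_triangle|].
  rewrite Cmod_mult.
  apply Rlt_div_r in H2; [|lra].
  pose proof (Cmod_ge_0 (w - z)%C). nra.
Qed.

Lemma ex_Cderive_inv (z : C) : z <> RtoC 0 -> ex_Cderive Cinv z.
Proof.
  intros Hz. exists (- / (z * z))%C. apply is_Cderive_iff. intros eps He.
  assert (0 < Cmod z) as Hm by now apply Cmod_gt_0.
  exists (Rmin (Cmod z / 2) (eps * (Cmod z)^3 / 2)).
  assert (0 < eps * Cmod z ^ 3 / 2) as Hq.
  { apply Rdiv_lt_0_compat; [|lra]. apply Rmult_lt_0_compat; [lra|]. now apply pow_lt. }
  split; [apply Rmin_pos; lra|].
  intros w Hw.
  assert (Cmod (w - z)%C < Cmod z / 2) as H1 by (eapply Rlt_le_trans; [exact Hw | apply Rmin_l]).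
  assert (Cmod (w - z)%C < eps * Cmod z ^ 3 / 2) as H2 by (eapply Rlt_le_trans; [exact Hw | apply Rmin_r]).
  assert (Cmod z / 2 < Cmod w) as H3.
  { pose proof (Cmod_triangle w (z - w)%C) as T.
    replace (w + (z - w))%C with z in T by ring.
    replace (z - w)%C with (- (w - z))%C in T by ring.
    rewrite Cmod_opp in T. lra. }
  assert (w <> RtoC 0) as Hw0 by (intros ->; rewrite Cmod_0 in H3; lra).
  replace (/ w - / z - - / (z * z) * (w - z))%C
    with ((w - z) * (w - z) / (z * z * w))%C
    by (field; split; assumption).
  rewrite Cmod_div by (repeat apply Cmult_neq_0; assumption).
  rewrite !Cmod_mult.
  pose proof (Cmod_ge_0 (w - z)%C) as Hp.
  apply Rle_div_l.
  { repeat apply Rmult_lt_0_compat; lra. }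
  assert (Cmod z * Cmod z * (Cmod z / 2) <= Cmod z * Cmod z * Cmod w) by nra.
  assert (Cmod (w - z)%C <= eps * (Cmod z * Cmod z * Cmod w)).
  { apply Rle_trans with (eps * (Cmod z * Cmod z * (Cmod z / 2))); [|nra].
    simpl in H2. lra. }
  nra.
Qed.

Lemma ex_Cderive_div (f g : C -> C) (z : C) :
  ex_Cderive f z -> ex_Cderive g z -> g z <> RtoC 0 ->
  ex_Cderive (fun w => f w / g w)%C z.
Proof.
  intros Hf Hg H0. apply ex_Cderive_mult; [exact Hf|].
  apply (ex_Cderive_comp Cinv g); [now apply ex_Cderive_inv | exact Hg].
Qed.

(** * The complex exponential and logarithm *)

(** The Cauchy-Riemann equations turn a real differential into a complex
    derivative. *)
Lemma differentiable_is_Cderive (p q : R -> R -> R) (x y a b : R) :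
  differentiable_pt_lim p x y a (- b) ->
  differentiable_pt_lim q x y b a ->
  is_Cderive (fun z => (p (Re z) (Im z), q (Re z) (Im z))) (x, y) (a, b).
Proof.
  intros Hp Hq. apply is_Cderive_iff. intros eps He.
  assert (0 < eps / 2) as He2 by lra.
  destruct (Hp (mkposreal _ He2)) as [d1 H1].
  destruct (Hq (mkposreal _ He2)) as [d2 H2].
  exists (Rmin d1 d2).
  split; [apply Rmin_pos; apply cond_pos|].
  intros [u v] Hw.
  set (c := Cmod ((u, v) - (x, y))%C) in *.
  assert (Rmax (Rabs (u - x)) (Rabs (v - y)) <= c) as Hm.
  { exact (Rmax_Cmod ((u, v) - (x, y))%C). }
  pose proof (Rmax_l (Rabs (u - x)) (Rabs (v - y))).
  pose proof (Rmax_r (Rabs (u - x)) (Rabs (v - y))).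
  pose proof (Rmin_l d1 d2). pose proof (Rmin_r d1 d2).
  specialize (H1 u v ltac:(lra) ltac:(lra)).
  specialize (H2 u v ltac:(lra) ltac:(lra)).
  cbn -[Rmax] in H1, H2. cbn [Re Im fst snd].
  replace ((p u v, q u v) - (p x y, q x y) - (a, b) * ((u, v) - (x, y)))%C
    with (RtoC (p u v - p x y - (a * (u - x) + - b * (v - y)))
          + Ci * RtoC (q u v - q x y - (b * (u - x) + a * (v - y))))%C.
  2: { apply injective_projections; cbn; ring. }
  eapply Rle_trans; [apply Cmod_triangle|].
  rewrite Cmod_mult, !Cmod_R.
  rewrite Cmod_Ci.
  nra.
Qed.

Definition Cexp (z : C) : C := (exp (Re z) * cos (Im z), exp (Re z) * sin (Im z)).

Lemma Cmod_Cexp (z : C) : Cmod (Cexp z) = exp (Re z).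
Proof.
  unfold Cmod, Cexp. cbn [fst snd].
  replace ((exp (Re z) * cos (Im z)) ^ 2 + (exp (Re z) * sin (Im z)) ^ 2)
    with (Rsqr (exp (Re z))).
  - apply sqrt_Rsqr. left; apply exp_pos.
  - pose proof (sin2_cos2 (Im z)) as H. unfold Rsqr in *. 
    transitivity (exp (Re z) * exp (Re z) * (sin (Im z) * sin (Im z) + cos (Im z) * cos (Im z))); [rewrite H; ring | ring].
Qed.

Lemma differentiable_pt_lim_eq (f : R -> R -> R) (x y a b a' b' : R) :
  differentiable_pt_lim f x y a b -> a = a' -> b = b' ->
  differentiable_pt_lim f x y a' b'.
Proof. intros H -> ->; exact H. Qed.

Lemma differentiable_fst (x y : R) : differentiable_pt_lim (fun u _ => u) x y 1 0.
Proof.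
  apply differentiable_pt_lim_proj1_0, is_derive_Reals. auto_derive; ring || trivial.
Qed.

Lemma differentiable_snd (x y : R) : differentiable_pt_lim (fun _ v => v) x y 0 1.
Proof.
  intros eps. exists eps. intros u v _ _.
  replace (v - y - (0 * (u - x) + 1 * (v - y))) with 0 by ring. rewrite Rabs_R0.
  apply Rmult_le_pos; [left; apply cond_pos|].
  eapply Rle_trans; [apply Rabs_pos | apply Rmax_l].
Qed.

Lemma differentiable_comp1 (f : R -> R) (g : R -> R -> R) (x y l gx gy : R) :
  is_derive f (g x y) l -> differentiable_pt_lim g x y gx gy ->
  differentiable_pt_lim (fun u v => f (g u v)) x y (l * gx) (l * gy).
Proof.
  intros Hf Hg.
  replace (l * gx) with (l * gx + 0 * gx) by ring.
  replace (l * gy) with (l * gy + 0 * gy) by ring.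
  apply (differentiable_pt_lim_comp (fun a _ => f a) g g); [|exact Hg..].
  apply differentiable_pt_lim_proj1_0, is_derive_Reals, Hf.
Qed.

Lemma differentiable_mult (f g : R -> R -> R) (x y fx fy gx gy : R) :
  differentiable_pt_lim f x y fx fy -> differentiable_pt_lim g x y gx gy ->
  differentiable_pt_lim (fun u v => f u v * g u v) x y
    (g x y * fx + f x y * gx) (g x y * fy + f x y * gy).
Proof.
  intros Hf Hg.
  apply (differentiable_pt_lim_comp (fun a b => a * b) f g); [|assumption..].
  intros eps. exists eps. intros u v Hu Hv.
  replace (u * v - f x y * g x y - (g x y * (u - f x y) + f x y * (v - g x y)))
    with ((u - f x y) * (v - g x y)) by ring.
  rewrite Rabs_mult.
  pose proof (Rmax_r (Rabs (u - f x y)) (Rabs (v - g x y))).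
  pose proof (Rabs_pos (u - f x y)). pose proof (Rabs_pos (v - g x y)). nra.
Qed.

Lemma ex_Cderive_Cexp (z : C) : ex_Cderive Cexp z.
Proof.
  destruct z as [x y].
  exists (exp x * cos y, exp x * sin y).
  pose proof (differentiable_comp1 exp (fun u _ => u) x y (exp x) 1 0
    ltac:(auto_derive; [trivial | ring]) (differentiable_fst x y)) as He.
  apply (differentiable_is_Cderive (fun x y => exp x * cos y) (fun x y => exp x * sin y)).
  - pose proof (differentiable_comp1 cos (fun _ v => v) x y (- sin y) 0 1
      ltac:(auto_derive; [trivial | ring]) (differentiable_snd x y)) as Hc.
    pose proof (differentiable_mult _ _ _ _ _ _ _ _ He Hc) as H.
    eapply differentiable_pt_lim_eq; [exact H | cbv beta; ring ..].
  - pose proof (differentiable_comp1 sin (fun _ v => v) x y (cos y) 0 1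
      ltac:(auto_derive; [trivial | ring]) (differentiable_snd x y)) as Hc.
    pose proof (differentiable_mult _ _ _ _ _ _ _ _ He Hc) as H.
    eapply differentiable_pt_lim_eq; [exact H | cbv beta; ring ..].
Qed.

(** The principal logarithm on the right half-plane; elsewhere the formula has no
    meaning. *)
Definition Clog (z : C) : C := (ln (Cmod z), atan (Im z / Re z)).

Lemma ex_Cderive_Clog (z : C) : 0 < Re z -> ex_Cderive Clog z.
Proof.
  destruct z as [x y]; cbn [Re fst]; intros Hx.
  assert (0 < x * x + y * y) as Hn by nra.
  exists (x / (x * x + y * y), - y / (x * x + y * y)).
  apply (is_derive_ext (K := C_AbsRing) (V := C_NormedModule)
    (fun z => (ln (sqrt (Re z * Re z + Im z * Im z)), atan (Im z * / Re z)))).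
  { intros [u v]. unfold Clog, Cmod; cbn [Re Im fst snd].
    do 4 f_equal; ring. }
  pose proof (differentiable_mult _ _ _ _ _ _ _ _ (differentiable_fst x y) (differentiable_fst x y)) as H1.
  pose proof (differentiable_mult _ _ _ _ _ _ _ _ (differentiable_snd x y) (differentiable_snd x y)) as H2.
  apply (differentiable_is_Cderive (fun x y => ln (sqrt (x * x + y * y))) (fun x y => atan (y * / x))).
  - assert (differentiable_pt_lim (fun a b => a + b) (x * x) (y * y) 1 1) as H3.
    { intros eps. exists eps. intros u v _ _.
      match goal with |- Rabs ?e <= _ => replace e with 0 by ring end. rewrite Rabs_R0.
      apply Rmult_le_pos; [left; apply cond_pos|].
      eapply Rle_trans; [apply Rabs_pos | apply Rmax_l]. }
    pose proof (differentiable_pt_lim_comp (fun a b => a + b) (fun u _ => u * u) (fun _ v => v * v) _ _ _ _ _ _ _ _ H3 H1 H2) as H4.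
    cbv beta in H4.
    assert (is_derive (fun t => ln (sqrt t)) (x * x + y * y) (/ (2 * (x * x + y * y)))) as HL.
    { pose proof (sqrt_lt_R0 _ Hn). pose proof (sqrt_sqrt (x * x + y * y) ltac:(lra)) as Hs.
      auto_derive; [repeat split; lra |].
      rewrite <- Hs at 3. field; lra. }
    pose proof (differentiable_comp1 (fun t => ln (sqrt t)) _ x y (/ (2 * (x * x + y * y))) _ _ 
HL H4) as H5.
    eapply differentiable_pt_lim_eq; [exact H5 | cbv beta; field; lra ..].
  - pose proof (differentiable_comp1 Rinv (fun u _ => u) x y (- / (x * x)) _ _
      ltac:(auto_derive; [lra | field; lra]) (differentiable_fst x y)) as H3.
    pose proof (differentiable_mult _ _ _ _ _ _ _ _ (differentiable_snd x y) H3) as H4.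
    cbv beta in H4.
    pose proof (differentiable_comp1 atan (fun x y => y * / x) x y (/ (1 + (y * / x) ^ 2)) _ _ 
      ltac:(apply is_derive_Reals, derivable_pt_lim_atan) H4) as H5.
    eapply differentiable_pt_lim_eq; [exact H5 | cbv beta; field; repeat split; nra ..].
Qed.

Lemma Re_Clog (z : C) : Re (Clog z) = ln (Cmod z).
Proof. reflexivity. Qed.

(** * Goursat's lemma and the mean value property *)

Lemma continuous_Re_vertical (f : C -> C) (x y : R) :
  ex_Cderive f (x, y) -> continuous (fun t => Re (f (x, t))) y.
Proof.
  intros H. apply continuity_pt_filterlim. intros eps He.
  destruct (proj1 (locally_Cmod _ _) (ex_Cderive_continuous _ _ H eps He)) as [d [Hd Hf]].
  exists d; split; [exact Hd|]. intros t [_ Ht]. cbn in *. unfold Rdist in *.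
  eapply Rle_lt_trans; [apply (re_le_Cmod (f (x, t) - f (x, y))%C)|].
  apply Hf. replace ((x, t) - (x, y))%C with (Ci * RtoC (t - y))%C
    by (apply injective_projections; cbn; ring).
  rewrite Cmod_mult, Cmod_R, Cmod_Ci. lra.
Qed.

Lemma continuous_Im_horizontal (f : C -> C) (x y : R) :
  ex_Cderive f (x, y) -> continuous (fun t => Im (f (t, y))) x.
Proof.
  intros H. apply continuity_pt_filterlim. intros eps He.
  destruct (proj1 (locally_Cmod _ _) (ex_Cderive_continuous _ _ H eps He)) as [d [Hd Hf]].
  exists d; split; [exact Hd|]. intros t [_ Ht]. cbn in *. unfold Rdist in *.
  eapply Rle_lt_trans; [apply (im_le_Cmod (f (t, y) - f (x, y))%C)|].
  apply Hf. replace ((t, y) - (x, y))%C with (RtoC (t - x))%C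
    by (apply injective_projections; cbn; ring).
  rewrite Cmod_R. lra.
Qed.
Lemma RInt_near_const (g : R -> R) (a b k e : R) :
  a <= b -> ex_RInt g a b -> (forall t, a <= t <= b -> Rabs (g t - k) <= e) ->
  Rabs (RInt g a b - (b - a) * k) <= (b - a) * e.
Proof.
  intros Hab Hg Hk.
  replace (RInt g a b - (b - a) * k) with (RInt (fun t => minus (g t) k) a b).
  - apply abs_RInt_le_const; [exact Hab | | exact Hk].
    apply (ex_RInt_minus (V := R_NormedModule)); [exact Hg | apply ex_RInt_const].
  - rewrite (RInt_minus (V := R_CompleteNormedModule));
      [| exact Hg | apply (ex_RInt_const (V := R_NormedModule))].
    rewrite RInt_const. reflexivity.
Qed.

Lemma dependent_choice {A : Type} (Q : nat -> A -> Prop) (T : nat -> A -> A -> Prop) (a0 : A) :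
  Q O a0 -> (forall n a, Q n a -> exists a', Q (S n) a' /\ T n a a') ->
  exists g : nat -> A, g O = a0 /\ forall n, Q n (g n) /\ T n (g n) (g (S n)).
Proof.
  intros H0 Hs.
  assert (forall n a, exists a', Q n a -> Q (S n) a' /\ T n a a') as Hs'.
  { intros n a. destruct (classic (Q n a)) as [H|H].
    - destruct (Hs n a H) as [a' Ha']. now exists a'.
    - exists a0. contradiction. }
  set (next := fun n a => proj1_sig (constructive_indefinite_description _ (Hs' n a))).
  exists (fix g n := match n with O => a0 | S m => next m (g m) end).
  split; [reflexivity|].
  intros n. induction n as [|n IH].
  - split; [exact H0|].
    now apply (proj2_sig (constructive_indefinite_description _ (Hs' O a0))).
  - destruct IH as [HQ _].
    match goal with |- Q _ ?u /\ _ => set (a := u) end.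
    assert (Q (S n) a) as Ha.
    { now apply (proj2_sig (constructive_indefinite_description _ (Hs' n _))). }
    split; [exact Ha|].
    now apply (proj2_sig (constructive_indefinite_description _ (Hs' (S n) a))).
Qed.

Lemma nested_intervals (a b : nat -> R) :
  (forall n, a n <= a (S n)) -> (forall n, b (S n) <= b n) -> (forall n, a n <= b n) ->
  exists x, forall n, a n <= x <= b n.
Proof.
  intros Ha Hb Hab.
  assert (forall n k, a n <= a (n + k)%nat) as Ha'.
  { intros n k. induction k; [rewrite Nat.add_0_r; lra|].
    rewrite Nat.add_succ_r. specialize (Ha (n + k)%nat). lra. }
  assert (forall n k, b (n + k)%nat <= b n) as Hb'.
  { intros n k. induction k; [rewrite Nat.add_0_r; lra|].
    rewrite Nat.add_succ_r. specialize (Hb (n + k)%nat). lra. }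
  assert (forall n m, a n <= b m) as Hnm.
  { intros n m. apply Rle_trans with (a (n + m)%nat); [apply Ha'|].
    eapply Rle_trans; [apply Hab|]. rewrite Nat.add_comm. apply Hb'. }
  destruct (completeness (fun x => exists n, x = a n)) as [x [Hub Hlub]].
  - exists (b O). intros y [n ->]. apply Hnm.
  - now exists (a O), O.
  - exists x. intros n; split; [apply Hub; now exists n|].
    apply Hlub. intros y [m ->]. apply Hnm.
Qed.

(** The imaginary part of the integral of [f dz] counterclockwise around the
    boundary of a rectangle, with opposite sides paired. *)
Definition contour (f : C -> C) (x0 x1 y0 y1 : R) : R :=
  RInt (fun y => Re (f (x1, y)) - Re (f (x0, y))) y0 y1 +
  RInt (fun x => Im (f (x, y0)) - Im (f (x, y1))) x0 x1.

Section rectangle.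
Variables (f : C -> C) (x0 x1 y0 y1 : R).
Hypothesis f_deriv : forall x y, x0 <= x <= x1 -> y0 <= y <= y1 -> ex_Cderive f (x, y).

Lemma ex_RInt_vertical (a b c d : R) :
  x0 <= a <= x1 -> x0 <= b <= x1 -> y0 <= c <= y1 -> y0 <= d <= y1 ->
  ex_RInt (fun y => Re (f (b, y)) - Re (f (a, y))) c d.
Proof.
  intros Ha Hb Hc Hd. apply (ex_RInt_continuous (V := R_CompleteNormedModule)).
  intros z Hz. apply (continuous_minus (V := R_NormedModule));
  apply continuous_Re_vertical, f_deriv; auto;
  revert Hz; unfold Rmin, Rmax; destruct (Rle_dec c d); lra.
Qed.

Lemma ex_RInt_horizontal (a b c d : R) :
  x0 <= a <= x1 -> x0 <= b <= x1 -> y0 <= c <= y1 -> y0 <= d <= y1 ->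
  ex_RInt (fun x => Im (f (x, c)) - Im (f (x, d))) a b.
Proof.
  intros Ha Hb Hc Hd. apply (ex_RInt_continuous (V := R_CompleteNormedModule)).
  intros z Hz. apply (continuous_minus (V := R_NormedModule));
  apply continuous_Im_horizontal, f_deriv; auto;
  revert Hz; unfold Rmin, Rmax; destruct (Rle_dec a b); lra.
Qed.

Lemma contour_split_x (a m b c d : R) :
  x0 <= a <= x1 -> x0 <= m <= x1 -> x0 <= b <= x1 -> y0 <= c <= y1 -> y0 <= d <= y1 ->
  contour f a b c d = contour f a m c d + contour f m b c d.
Proof.
  intros. unfold contour.
  rewrite <- (RInt_Chasles (V := R_CompleteNormedModule) (fun x => Im (f (x, c)) - Im (f (x, d))) a m b)
    by now apply ex_RInt_horizontal.
  rewrite (RInt_ext (fun y => Re (f (b, y)) - Re (f (a, y)))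
    (fun y => plus (Re (f (m, y)) - Re (f (a, y))) (Re (f (b, y)) - Re (f (m, y)))))
    by (intros; cbn; ring).
  rewrite (RInt_plus (V := R_CompleteNormedModule)) by now apply ex_RInt_vertical.
  cbn; ring.
Qed.

Lemma contour_split_y (a b c m d : R) :
  x0 <= a <= x1 -> x0 <= b <= x1 -> y0 <= c <= y1 -> y0 <= m <= y1 -> y0 <= d <= y1 ->
  contour f a b c d = contour f a b c m + contour f a b m d.
Proof.
  intros. unfold contour.
  rewrite <- (RInt_Chasles (V := R_CompleteNormedModule) (fun y => Re (f (b, y)) - Re (f (a, y))) c m d)
    by now apply ex_RInt_vertical.
  rewrite (RInt_ext (fun x => Im (f (x, c)) - Im (f (x, d)))
    (fun x => plus (Im (f (x, c)) - Im (f (x, m))) (Im (f (x, m)) - Im (f (x, d)))))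
    by (intros; cbn; ring).
  rewrite (RInt_plus (V := R_CompleteNormedModule)) by now apply ex_RInt_horizontal.
  cbn; ring.
Qed.

(** The linear part of [f] at [z] integrates to zero around every rectangle, so
    only the remainder of the derivative is left. *)
Lemma contour_small (z : C) (eps : R) :
  0 < eps -> ex_Cderive f z -> exists d, 0 < d /\
  forall a b c e, x0 <= a -> b <= x1 -> y0 <= c -> e <= y1 ->
    a <= Re z <= b -> c <= Im z <= e -> (b - a) + (e - c) < d ->
    Rabs (contour f a b c e) <= 2 * eps * ((b - a) + (e - c)) ^ 2.
Proof.
  intros He [l Hl].
  destruct (proj1 (is_Cderive_iff f z l) Hl eps He) as [d [Hd H]].
  exists d; split; [exact Hd|].
  intros a b c e Ha Hb Hc Hee Hz1 Hz2 Hs.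
  set (S := (b - a) + (e - c)) in *.
  assert (forall x y, a <= x <= b -> c <= y <= e ->
    Cmod (f (x, y) - f z - l * ((x, y) - z))%C <= eps * S) as HE.
  { intros x y Hx Hy.
    assert (Cmod ((x, y) - z)%C <= S) as Hm.
    { replace ((x, y) - z)%C with (RtoC (x - Re z) + Ci * RtoC (y - Im z))%C
        by (destruct z; apply injective_projections; cbn; ring).
      eapply Rle_trans; [apply Cmod_triangle|].
      rewrite Cmod_mult, !Cmod_R, Cmod_Ci. unfold S.
      assert (Rabs (x - Re z) <= b - a) by (apply Rabs_le; lra).
      assert (Rabs (y - Im z) <= e - c) by (apply Rabs_le; lra). lra. }
    eapply Rle_trans; [apply H; lra|]. apply Rmult_le_compat_l; lra. }
  unfold contour.
  assert (Rabs (RInt (fun y => Re (f (b, y)) - Re (f (a, y))) c e - (e - c) * (Re l * (b - a)))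
          <= (e - c) * (2 * eps * S)) as H1.
  { apply RInt_near_const; [lra | apply ex_RInt_vertical; lra |].
    intros t Ht.
    pose proof (HE b t ltac:(lra) Ht) as A1. pose proof (HE a t ltac:(lra) Ht) as A2.
    pose proof (re_le_Cmod (f (b, t) - f z - l * ((b, t) - z))%C) as B1.
    pose proof (re_le_Cmod (f (a, t) - f z - l * ((a, t) - z))%C) as B2.
    replace (Re (f (b, t)) - Re (f (a, t)) - Re l * (b - a)) with
      (Re (f (b, t) - f z - l * ((b, t) - z))%C - Re (f (a, t) - f z - l * ((a, t) - z))%C)
      by (unfold Re, Im; cbn; ring).
    eapply Rle_trans; [apply Rabs_triang|]. rewrite Rabs_Ropp. lra. }
  assert (Rabs (RInt (fun x => Im (f (x, c)) - Im (f (x, e))) a b - (b - a) * (Re l * (c - e)))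
          <= (b - a) * (2 * eps * S)) as H2.
  { apply RInt_near_const; [lra | apply ex_RInt_horizontal; lra |].
    intros t Ht.
    pose proof (HE t c Ht ltac:(lra)) as A1. pose proof (HE t e Ht ltac:(lra)) as A2.
    pose proof (im_le_Cmod (f (t, c) - f z - l * ((t, c) - z))%C) as B1.
    pose proof (im_le_Cmod (f (t, e) - f z - l * ((t, e) - z))%C) as B2.
    replace (Im (f (t, c)) - Im (f (t, e)) - Re l * (c - e)) with
      (Im (f (t, c) - f z - l * ((t, c) - z))%C - Im (f (t, e) - f z - l * ((t, e) - z))%C)
      by (unfold Re, Im; cbn; ring).
    eapply Rle_trans; [apply Rabs_triang|]. rewrite Rabs_Ropp. lra. }
  match goal with |- Rabs (?A + ?B) <= _ => set (I1 := A) in *; set (I2 := B) in * end.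
  replace (I1 + I2) with ((I1 - (e - c) * (Re l * (b - a))) + (I2 - (b - a) * (Re l * (c - e)))) by ring.
  eapply Rle_trans; [apply Rabs_triang|].
  replace (2 * eps * S ^ 2) with ((e - c) * (2 * eps * S) + (b - a) * (2 * eps * S))
    by (unfold S; ring). lra.
Qed.

(** Goursat's lemma. If the integral were not zero, repeated quartering would
    give nested rectangles on which it stays proportional to the area; near the
    common point of the rectangles this contradicts [contour_small], because all
    of them have the same shape. *)
Lemma contour_zero : x0 < x1 -> y0 < y1 -> contour f x0 x1 y0 y1 = 0.
Proof.
  intros Hx Hy.
  set (W := x1 - x0). set (H := y1 - y0).
  assert (0 < W) as HW by (unfold W; lra). assert (0 < H) as HH by (unfold H; lra).
  destruct (Req_dec (contour f x0 x1 y0 y1) 0) as [E|E]; [exact E | exfalso].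
  assert (0 < Rabs (contour f x0 x1 y0 y1)) as Hpos by now apply Rabs_pos_lt.
  set (K := Rabs (contour f x0 x1 y0 y1) / (2 * W * H)).
  assert (0 < K) as HK by (apply Rdiv_lt_0_compat; [exact Hpos|]; repeat apply Rmult_lt_0_compat; lra).
  set (w := fun n => W * (/2) ^ n). set (h := fun n => H * (/2) ^ n).
  assert (forall n, 0 < w n) as Hw by (intros n; apply Rmult_lt_0_compat; [lra | apply pow_lt; lra]).
  assert (forall n, 0 < h n) as Hh by (intros n; apply Rmult_lt_0_compat; [lra | apply pow_lt; lra]).
  assert (forall n, w n = 2 * w (S n)) as Hw2 by (intros n; unfold w; cbn; field).
  assert (forall n, h n = 2 * h (S n)) as Hh2 by (intros n; unfold h; cbn; field).
  (* [Q n p]: the [n]-th rectangle with lower left corner [p] still has a large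
     integral; [T n p p']: the rectangle at [p'] lies in the one at [p]. *)
  set (Q := fun n (p : R * R) => x0 <= fst p /\ fst p + w n <= x1 /\
    y0 <= snd p /\ snd p + h n <= y1 /\
    K * (w n * h n) < Rabs (contour f (fst p) (fst p + w n) (snd p) (snd p + h n))).
  set (T := fun n (p p' : R * R) => fst p <= fst p' /\ fst p' + w (S n) <= fst p + w n /\
    snd p <= snd p' /\ snd p' + h (S n) <= snd p + h n).
  destruct (dependent_choice Q T (x0, y0)) as [g [Hg0 Hg]].
  - unfold Q, w, h; cbn [fst snd pow]. rewrite !Rmult_1_r.
    replace (x0 + W) with x1 by (unfold W; ring). replace (y0 + H) with y1 by (unfold H; ring).
    repeat split; try lra.
    unfold K. replace (Rabs (contour f x0 x1 y0 y1) / (2 * W * H) * (W * H))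
      with (Rabs (contour f x0 x1 y0 y1) / 2) by (field; lra). lra.
  - intros n [a b] (Q1 & Q2 & Q3 & Q4 & Q5). cbn [fst snd] in *.
    pose proof (Hw (S n)) as Hwn. pose proof (Hh (S n)) as Hhn.
    pose proof (Hw2 n) as Hwn2. pose proof (Hh2 n) as Hhn2.
    set (m := a + w (S n)). set (k := b + h (S n)).
    assert (a + w n = m + w (S n)) as Em by (unfold m; lra).
    assert (b + h n = k + h (S n)) as Ek by (unfold k; lra).
    rewrite Em, Ek in *.
    rewrite (contour_split_x a m (m + w (S n))) in Q5 by (unfold m, k in *; lra).
    rewrite (contour_split_y a m b k) in Q5 by (unfold m, k in *; lra).
    rewrite (contour_split_y m _ b k) in Q5 by (unfold m, k in *; lra).
    replace (w n * h n) with (4 * (w (S n) * h (S n))) in Q5 by (rewrite Hwn2, Hhn2; ring).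
    destruct (Rlt_le_dec (K * (w (S n) * h (S n))) (Rabs (contour f a m b k))) as [L1|L1].
    { exists (a, b). unfold Q, T; cbn [fst snd]. fold m k. repeat split; unfold m, k in *; lra. }
    destruct (Rlt_le_dec (K * (w (S n) * h (S n))) (Rabs (contour f a m k (k + h (S n))))) as [L2|L2].
    { exists (a, k). unfold Q, T; cbn [fst snd]. fold m. repeat split; unfold m, k in *; lra. }
    destruct (Rlt_le_dec (K * (w (S n) * h (S n))) (Rabs (contour f m (m + w (S n)) b k))) as [L3|L3].
    { exists (m, b). unfold Q, T; cbn [fst snd]. fold k. repeat split; unfold m, k in *; lra. }
    destruct (Rlt_le_dec (K * (w (S n) * h (S n))) (Rabs (contour f m (m + w (S n)) k (k + h (S n))))) as [L4|L4].
    { exists (m, k). unfold Q, T; cbn [fst snd]. repeat split; unfold m, k in *; lra. }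
    exfalso. apply (Rlt_not_le _ _ Q5).
    eapply Rle_trans; [apply Rabs_triang|].
    eapply Rle_trans; [apply Rplus_le_compat; apply Rabs_triang|]. lra.
  - destruct (nested_intervals (fun n => fst (g n)) (fun n => fst (g n) + w n)) as [x Hxn].
    { intros n; apply (Hg n). } { intros n; apply (Hg n). } { intros n; pose proof (Hw n); lra. }
    destruct (nested_intervals (fun n => snd (g n)) (fun n => snd (g n) + h n)) as [y Hyn].
    { intros n; apply (Hg n). } { intros n; apply (Hg n). } { intros n; pose proof (Hh n); lra. }
    (* With this [eps] the bound of [contour_small] is [K] times the area. *)
    set (eps := K * (W * H) / (2 * (W + H) ^ 2)).
    assert (0 < eps) as Heps.
    { unfold eps. apply Rdiv_lt_0_compat; [apply Rmult_lt_0_compat; nra |].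
      apply Rmult_lt_0_compat; [lra | apply pow_lt; lra]. }
    destruct (contour_small (x, y) eps Heps) as [d [Hd Hc]].
    { destruct (Hg O) as [(Q1 & Q2 & Q3 & Q4 & _) _].
      specialize (Hxn O). specialize (Hyn O). cbn beta in Hxn, Hyn. apply f_deriv; lra. }
    destruct (pow_lt_1_zero (/2) ltac:(rewrite Rabs_right; lra) (d / (W + H))) as [n Hn].
    { apply Rdiv_lt_0_compat; lra. }
    specialize (Hn n (Nat.le_refl n)).
    rewrite Rabs_right in Hn by (left; apply Rlt_gt, pow_lt; lra).
    apply Rlt_div_r in Hn; [|lra].
    destruct (Hg n) as [(Q1 & Q2 & Q3 & Q4 & Q5) _].
    specialize (Hxn n). specialize (Hyn n). cbn beta in Hxn, Hyn.
    specialize (Hc _ _ _ _ Q1 Q2 Q3 Q4 Hxn Hyn).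
    replace (fst (g n) + w n - fst (g n)) with (w n) in Hc by ring.
    replace (snd (g n) + h n - snd (g n)) with (h n) in Hc by ring.
    apply (Rlt_not_le _ _ Q5). eapply Rle_trans; [apply Hc; unfold w, h; lra|].
    apply Req_le. unfold eps, w, h. field. lra.
Qed.
End rectangle.

Definition circle (c : C) (r t : R) : C := (c + RtoC r * (cos t, sin t))%C.

Lemma ex_Cderive_log_polar (f : C -> C) (c w : C) (r : R) :
  ex_Cderive f (c + RtoC r * Cexp w)%C ->
  ex_Cderive (fun w => f (c + RtoC r * Cexp w)%C) w.
Proof.
  intros H. apply (ex_Cderive_comp f); [exact H|].
  apply ex_Cderive_plus; [apply ex_Cderive_const|].
  apply ex_Cderive_mult; [apply ex_Cderive_const | apply ex_Cderive_Cexp].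
Qed.

(** In logarithmic polar coordinates the circles around [c] become vertical
    segments of length [2 PI], and periodicity cancels the horizontal sides in
    Goursat's lemma. So the mean over a circle does not depend on the radius; let
    the radius tend to zero. *)
Lemma mean_value (f : C -> C) (c : C) (r : R) :
  0 < r -> (forall z, Cmod (z - c)%C <= r -> ex_Cderive f z) ->
  ex_RInt (fun t => Re (f (circle c r t))) 0 (2 * PI) /\
  RInt (fun t => Re (f (circle c r t))) 0 (2 * PI) = 2 * PI * Re (f c).
Proof.
  intros Hr Hf. pose proof PI_RGT_0 as Hpi.
  set (F := fun w => f (c + RtoC r * Cexp w)%C).
  assert (forall x y, x <= 0 -> ex_Cderive F (x, y)) as HF.
  { intros x y Hx. apply ex_Cderive_log_polar, Hf.
    replace (c + RtoC r * Cexp (x, y) - c)%C with (RtoC r * Cexp (x, y))%C by ring.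
    rewrite Cmod_mult, Cmod_R, Cmod_Cexp, Rabs_right by lra. cbn [Re fst].
    pose proof (exp_le_compat x 0 Hx). rewrite exp_0 in *. pose proof (exp_pos x). nra. }
  assert (forall x, x <= 0 -> ex_RInt (fun y => Re (F (x, y))) 0 (2 * PI)) as HI.
  { intros x Hx. apply (ex_RInt_continuous (V := R_CompleteNormedModule)).
    intros; now apply continuous_Re_vertical, HF. }
  assert (forall t, circle c r t = (c + RtoC r * Cexp (0, t))%C) as Ecirc.
  { intros t. unfold circle, Cexp; cbn [Re Im fst snd]. now rewrite exp_0, !Rmult_1_l. }
  assert (ex_RInt (fun t => Re (f (circle c r t))) 0 (2 * PI)) as Hex.
  { apply (ex_RInt_ext (fun y => Re (F (0, y)))); [|apply HI; lra].
    intros t _. now rewrite Ecirc. }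
  split; [exact Hex|].
  rewrite (RInt_ext _ (fun y => Re (F (0, y)))) by (intros t _; now rewrite Ecirc).
  assert (forall x, x < 0 -> RInt (fun y => Re (F (0, y))) 0 (2 * PI) =
    RInt (fun y => Re (F (x, y))) 0 (2 * PI)) as Hinv.
  { intros x Hx.
    pose proof (contour_zero F x 0 0 (2 * PI)) as H. unfold contour in H.
    rewrite (RInt_ext (fun x => Im (F (x, 0)) - Im (F (x, 2 * PI))) (fun _ => 0)) in H.
    2: { intros s _. unfold F, Cexp; cbn [Re Im fst snd].
         rewrite cos_2PI, sin_2PI, cos_0, sin_0. apply Rplus_opp_r. }
    rewrite RInt_const in H. rewrite (RInt_minus (V := R_CompleteNormedModule)) in H by (apply HI; lra).
    cbn in H. unfold plus, minus, opp, scal, mult in H; cbn in H. unfold mult in H; cbn in H.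
    enough (RInt (fun y => Re (F (0, y))) 0 (2 * PI) + - RInt (fun y => Re (F (x, y))) 0 (2 * PI) + (0 - x) * 0 = 0) by lra.
    apply H; [|lra..]. intros; apply HF; lra. }
  apply cond_eq. intros eps Heps.
  destruct (proj1 (locally_Cmod _ _) (ex_Cderive_continuous f c (Hf c ltac:(
     replace (c - c)%C with (RtoC 0) by ring; rewrite Cmod_0; lra)) (eps / (4 * PI))
     ltac:(apply Rdiv_lt_0_compat; lra))) as [d [Hd Hc]].
  set (x := Rmin (-1) (ln (d / (2 * r)))).
  assert (x <= -1) as Hx1 by apply Rmin_l.
  assert (0 < d / (2 * r)) as Hq by (apply Rdiv_lt_0_compat; lra).
  assert (r * exp x < d) as Hx2.
  { apply Rle_lt_trans with (r * (d / (2 * r))).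
    - apply Rmult_le_compat_l; [lra|]. rewrite <- (exp_ln (d / (2 * r)) Hq).
      apply exp_le_compat, Rmin_r.
    - replace (r * (d / (2 * r))) with (d / 2) by (field; lra). lra. }
  rewrite (Hinv x) by lra.
  replace (2 * PI * Re (f c)) with ((2 * PI - 0) * Re (f c)) by ring.
  eapply Rle_lt_trans; [apply RInt_near_const with (e := eps / (4 * PI));
    [lra | apply HI; lra |]|].
  - intros t _. left. eapply Rle_lt_trans; [apply (re_le_Cmod (F (x, t) - f c)%C)|].
    apply Hc. replace (c + RtoC r * Cexp (x, t) - c)%C with (RtoC r * Cexp (x, t))%C by ring.
    rewrite Cmod_mult, Cmod_R, Cmod_Cexp, Rabs_right by lra. exact Hx2.
  - replace ((2 * PI - 0) * (eps / (4 * PI))) with (eps / 2) by (field; lra). lra.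
Qed.

(** * The maximum modulus principle *)

Definition box (r : R) (z : C) : Prop := Rabs (Re z) <= r /\ Rabs (Im z) <= r.

Lemma box_of_Cmod (r : R) (z : C) : Cmod z <= r -> box r z.
Proof.
  intros H. split; (eapply Rle_trans; [|exact H]);
  [apply re_le_Cmod | apply im_le_Cmod].
Qed.

(** Compactness of a square, in the form of a Lebesgue number: a property that
    holds near each point at some scale holds everywhere at a common scale. *)
Lemma box_uniform (r : R) (P : R -> C -> Prop) :
  (forall d d' z, 0 < d' <= d -> P d z -> P d' z) ->
  (forall z, box r z -> exists d, 0 < d /\ locally z (P d)) ->
  exists d, 0 < d /\ forall z, box r z -> P d z.
Proof.
  intros Hanti Hloc.
  assert (forall u v, exists d : posreal, box r (u, v) ->
    forall x y, Rabs (x - u) < d -> Rabs (y - v) < d -> P d (x, y)) as Hd.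
  { intros u v. destruct (classic (box r (u, v))) as [Hb|Hb].
    - destruct (Hloc _ Hb) as [d [Hd [e He]]].
      assert (0 < Rmin d e) as Hm by (apply Rmin_pos; [exact Hd | apply cond_pos]).
      exists (mkposreal _ Hm). intros _ x y Hx Hy; cbn in Hx, Hy.
      pose proof (Rmin_l d e). pose proof (Rmin_r d e).
      apply Hanti with d; [cbn; lra|]. apply He. split; cbn.
      + change (Rabs (x - u) < e). lra.
      + change (Rabs (y - v) < e). lra.
    - exists (mkposreal 1 Rlt_0_1). contradiction. }
  set (delta := fun u v => proj1_sig (constructive_indefinite_description _ (Hd u v))).
  destruct (compactness_value_2d (-r) r (-r) r delta) as [d Hcov].
  exists d; split; [apply cond_pos|].
  intros [x y] [Hx Hy]; cbn [Re Im fst snd] in Hx, Hy.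
  apply Rabs_le_between in Hx. apply Rabs_le_between in Hy.
  apply NNPP. intros HP. apply (Hcov x y Hx Hy). intros (u & v & Hu & Hv & H1 & H2 & H3).
  apply HP. apply Hanti with (delta u v); [split; [apply cond_pos | exact H3]|].
  apply (proj2_sig (constructive_indefinite_description _ (Hd u v))); [|exact H1|exact H2].
  split; now apply Rabs_le_between.
Qed.

Lemma box_max (r : R) (w : C -> R) :
  0 <= r ->
  (forall z eps, 0 < eps -> locally z (fun z' => w z' < w z + eps)) ->
  exists z0, box r z0 /\ forall z, box r z -> w z <= w z0.
Proof.
  intros Hr Husc.
  assert (box r (RtoC 0)) as H0 by (split; cbn; rewrite Rabs_R0; exact Hr).
  destruct (box_uniform r (fun d z => w z <= / d)) as [d0 [Hd0 Hb]].
  { intros d d' z Hd H. eapply Rle_trans; [exact H|]. apply Rinv_le_contravar; lra. }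
  { intros z Hz. exists (/ (Rabs (w z) + 1)). pose proof (Rabs_pos (w z)).
    split; [apply Rinv_0_lt_compat; lra|].
    rewrite Rinv_inv. eapply filter_imp; [|apply (Husc z 1 Rlt_0_1)].
    intros z'. pose proof (Rle_abs (w z)). lra. }
  destruct (completeness (fun y => exists z, box r z /\ y = w z)) as [S [Hub Hlub]].
  { exists (/ d0). intros y [z [Hz ->]]. now apply Hb. }
  { now exists (w (RtoC 0)), (RtoC 0). }
  apply NNPP. intros Hno.
  assert (forall z, box r z -> w z < S) as Hlt.
  { intros z Hz. apply Rnot_le_lt. intros HS. apply Hno. exists z; split; [exact Hz|].
    intros z' Hz'. apply Rle_trans with S; [|exact HS]. apply Hub. now exists z'. }
  destruct (box_uniform r (fun d z => w z <= S - d)) as [d [Hd HS]].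
  { intros; lra. }
  { intros z Hz. specialize (Hlt z Hz). exists ((S - w z) / 2). split; [lra|].
    eapply filter_imp; [|apply (Husc z ((S - w z) / 2)); lra]. intros z'; cbn beta; lra. }
  assert (S <= S - d); [|lra]. apply Hlub. intros y [z [Hz ->]]. now apply HS.
Qed.

Lemma locally_Cmod_sqr_lt (z : C) (eps : R) :
  0 < eps -> locally z (fun w => Cmod w ^ 2 < Cmod z ^ 2 + eps).
Proof.
  intros He.
  eapply filter_imp; [|apply (ex_Cderive_continuous (fun w => w * w)%C z) with (eps := eps);
    [apply ex_Cderive_mult; apply ex_Cderive_id | exact He]].
  intros w Hw. cbn beta in Hw.
  pose proof (Cmod_triangle (w * w - z * z) (z * z))%C as T.
  replace (w * w - z * z + z * z)%C with (w * w)%C in T by ring.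
  rewrite !Cmod_mult in T. simpl. lra.
Qed.

Lemma locally_Cmod_lt (f : C -> C) (z : C) (eps : R) :
  0 < eps -> ex_Cderive f z -> locally z (fun w => Cmod (f w) < Cmod (f z) + eps).
Proof.
  intros He Hf. eapply filter_imp; [|apply (ex_Cderive_continuous f z Hf eps He)].
  intros w Hw. cbn beta in Hw.
  pose proof (Cmod_triangle (f w - f z) (f z))%C as T.
  replace (f w - f z + f z)%C with (f w) in T by ring. lra.
Qed.

Lemma Cmod_Cconj (z : C) : Cmod (Cconj z) = Cmod z.
Proof. unfold Cmod, Cconj; cbn [fst snd]. f_equal. ring. Qed.

(** The function [|f| + kappa |z|^2] lies strictly below its mean over small
    circles, by [kappa r^2], so it has no local maximum. This strictness spares
    the discussion of functions of constant modulus. *)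
Lemma no_interior_max (f : C -> C) (z0 : C) (kappa : R) :
  0 < kappa -> locally z0 (fun z : C => ex_Cderive f z) ->
  ~ locally z0 (fun z => Cmod (f z) + kappa * Cmod z ^ 2 <= Cmod (f z0) + kappa * Cmod z0 ^ 2).
Proof.
  intros Hk Hf Hmax.
  destruct (proj1 (locally_Cmod _ _) (filter_and _ _ Hf Hmax)) as [d [Hd H]].
  set (r := d / 2). assert (0 < r) as Hr by (unfold r; lra).
  assert (exists lam : C, Cmod lam = 1 /\ (lam * f z0)%C = RtoC (Cmod (f z0))) as [lam [Hl1 Hl2]].
  { destruct (classic (f z0 = RtoC 0)) as [E|E].
    - exists (RtoC 1). rewrite E, Cmod_1, Cmod_0. split; [reflexivity | ring].
    - assert (Cmod (f z0) <> 0) as Hn by (apply Rgt_not_eq, Cmod_gt_0, E).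
      exists (Cconj (f z0) / RtoC (Cmod (f z0)))%C. split.
      + rewrite Cmod_div by (intros HC; apply Hn; now apply RtoC_inj).
        rewrite Cmod_Cconj, Cmod_R, Rabs_right by (apply Rle_ge, Cmod_ge_0). now field.
      + assert (RtoC (Cmod (f z0)) <> RtoC 0) as Hn' by (intros HC; apply Hn; now apply RtoC_inj).
        transitivity (f z0 * Cconj (f z0) / RtoC (Cmod (f z0)))%C; [now field|].
        rewrite <- Cmod2_conj, RtoC_pow. now field. }
  (* [lam] rotates [f z0] to the positive axis, so that [Re (lam * f)] touches
     [|f|] at [z0]; the linear term accounts for the variation of [kappa |z|^2]
     along the circle. *)
  set (g := fun z => (lam * f z + RtoC (2 * kappa) * Cconj z0 * (z - z0))%C).
  destruct (mean_value g z0 r Hr) as [Hex Hmean].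
  { intros z Hz. unfold g. apply ex_Cderive_plus.
    - apply ex_Cderive_mult; [apply ex_Cderive_const|]. apply H. unfold r in Hz; lra.
    - apply ex_Cderive_mult; [apply ex_Cderive_const|].
      apply ex_Cderive_minus_const. }
  replace (Re (g z0)) with (Cmod (f z0)) in Hmean.
  2: { unfold g. rewrite Hl2. replace (z0 - z0)%C with (RtoC 0) by ring.
       rewrite Cmult_0_r, Cplus_0_r. reflexivity. }
  pose proof PI_RGT_0 as Hpi.
  assert (RInt (fun t => Re (g (circle z0 r t))) 0 (2 * PI) <=
          RInt (fun _ => Cmod (f z0) - kappa * r ^ 2) 0 (2 * PI)) as Hle.
  { apply RInt_le; [lra | exact Hex | apply ex_RInt_const |].
    intros t _. set (p := circle z0 r t).
    assert (Cmod (p - z0)%C = r) as Hp.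
    { unfold p, circle. replace (z0 + RtoC r * (cos t, sin t) - z0)%C with (RtoC r * (cos t, sin t))%C by ring.
      rewrite Cmod_mult, Cmod_R, Rabs_right by lra.
      replace (Cmod (cos t, sin t)) with 1; [ring|].
      unfold Cmod; cbn [fst snd]. rewrite <- sqrt_1. f_equal.
      pose proof (sin2_cos2 t) as S. unfold Rsqr in S. rewrite <- S. ring. }
    assert (Cmod (p - z0)%C < d) as Hpd by (unfold r in Hp; lra).
    destruct (H p Hpd) as [_ Hb].
    pose proof (re_le_Cmod (lam * f p)%C) as Hre. rewrite Cmod_mult, Hl1 in Hre.
    pose proof (Rle_abs (Re (lam * f p)%C)).
    assert (Cmod p ^ 2 = Cmod z0 ^ 2 + r ^ 2 + 2 * Re (Cconj z0 * (p - z0))%C) as Hsq.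
    { rewrite <- Hp, !Cmod2_alt. destruct p, z0; cbn; ring. }
    unfold g. replace (Re (lam * f p + RtoC (2 * kappa) * Cconj z0 * (p - z0))%C)
      with (Re (lam * f p)%C + 2 * kappa * Re (Cconj z0 * (p - z0))%C).
    2: { generalize (lam * f p)%C; intros [a b]. destruct p, z0; unfold Re; cbn; ring. }
    rewrite Hsq in Hb. lra. }
  rewrite Hmean, RInt_const in Hle. unfold scal in Hle; cbn in Hle. unfold mult in Hle; cbn in Hle.
  assert (0 < kappa * (r * r)) by (repeat apply Rmult_lt_0_compat; lra).
  nra.
Qed.

(** A point is handled in one of two ways: it is interior and [f] is
    differentiable near it, or [f] is almost bounded by [M] near it. The second
    covers boundary points, at which [f] need not extend continuously, as well as
    points away from [Om]. *)
Lemma max_modulus_bounded (Om : C -> Prop) (f : C -> C) (M r : R) :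
  (forall z, Om z -> Cmod z < r) ->
  (forall z, locally z (fun w => Om w /\ ex_Cderive f w) \/
     forall eps, 0 < eps -> locally z (fun w => Om w -> Cmod (f w) <= M + eps)) ->
  forall z, Om z -> Cmod (f z) <= M.
Proof.
  intros Hbd Hloc z1 Hz1. apply Rnot_lt_le. intros HM.
  pose proof (Hbd z1 Hz1) as Hr1. pose proof (Cmod_ge_0 z1) as Hr0.
  set (M' := (M + Cmod (f z1)) / 2).
  set (kappa := (Cmod (f z1) - M') / (4 * r ^ 2)).
  assert (0 < r ^ 2) as Hr2 by (apply pow_lt; lra).
  assert (0 < kappa) as Hk by (apply Rdiv_lt_0_compat; unfold M'; lra).
  (* The truncation [v] of [|f|] is upper semicontinuous on the whole plane, hence
     attains a maximum; adding [kappa |z|^2] keeps the maximum inside [Om]. *)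
  set (v := fun z => if excluded_middle_informative (Om z) then Rmax (Cmod (f z)) M' else M').
  assert (forall z, M' <= v z) as HvM.
  { intros z. unfold v. destruct (excluded_middle_informative (Om z)); [apply Rmax_r | lra]. }
  assert (forall z, Om z -> v z = Rmax (Cmod (f z)) M') as HvO.
  { intros z Hz. unfold v. now destruct (excluded_middle_informative (Om z)). }
  assert (forall z c, M' < c -> (Om z -> Cmod (f z) < c) -> v z < c) as Hvlt.
  { intros z c Hc Hf. unfold v. destruct (excluded_middle_informative (Om z)) as [Hz|Hz]; [|exact Hc].
    apply Rmax_lub_lt; auto. }
  destruct (box_max r (fun z => v z + kappa * Cmod z ^ 2)) as [z0 [Hz0 Hmax]].
  { lra. }
  { intros z eps He.
    assert (locally z (fun z' => v z' < v z + eps / 2)) as Hv.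
    { destruct (Hloc z) as [H|H].
      - destruct (locally_singleton _ _ H) as [Hz Hf].
        eapply filter_imp; [|apply (locally_Cmod_lt f z (eps / 2)); [lra | exact Hf]].
        intros w Hw. cbn beta in Hw. pose proof (HvM z). apply Hvlt; [lra|]. intros _.
        rewrite (HvO z Hz). pose proof (Rmax_l (Cmod (f z)) M'). lra.
      - assert (0 < M' - M) as He' by (unfold M'; lra).
        eapply filter_imp; [|apply (H (M' - M) He')].
        intros w Hw. pose proof (HvM z). apply Hvlt; [lra|]. intros HO. specialize (Hw HO). lra. }
    assert (0 < eps / 2 / kappa) as He2 by (apply Rdiv_lt_0_compat; lra).
    eapply filter_imp; [|apply (filter_and _ _ Hv (locally_Cmod_sqr_lt z _ He2))].
    intros w [H1 H2].
    assert (kappa * Cmod w ^ 2 < kappa * Cmod z ^ 2 + eps / 2).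
    { replace (eps / 2) with (kappa * (eps / 2 / kappa)) by (field; lra).
      rewrite <- Rmult_plus_distr_l. now apply Rmult_lt_compat_l. }
    lra. }
  cbn beta in Hmax.
  assert (Cmod (f z1) <= v z0 + kappa * Cmod z0 ^ 2) as H1.
  { eapply Rle_trans; [|apply (Hmax z1), box_of_Cmod; lra].
    rewrite (HvO z1 Hz1). pose proof (Rmax_l (Cmod (f z1)) M').
    assert (0 <= kappa * Cmod z1 ^ 2) by (apply Rmult_le_pos; [lra | apply pow2_ge_0]). lra. }
  assert (M' < v z0) as Hv0.
  { assert (kappa * Cmod z0 ^ 2 <= (Cmod (f z1) - M') / 2).
    { replace ((Cmod (f z1) - M') / 2) with (kappa * (2 * r ^ 2)) by (unfold kappa; field; lra).
      apply Rmult_le_compat_l; [lra|]. rewrite Cmod2_alt. destruct Hz0 as [A B].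
      assert (Re z0 ^ 2 <= r ^ 2) by (rewrite <- (pow2_abs (Re z0)); apply pow_incr; split; [apply Rabs_pos | exact A]).
      assert (Im z0 ^ 2 <= r ^ 2) by (rewrite <- (pow2_abs (Im z0)); apply pow_incr; split; [apply Rabs_pos | exact B]).
      lra. }
    unfold M' in *. lra. }
  assert (Om z0 /\ v z0 = Cmod (f z0)) as [HO0 Hvf].
  { unfold v in Hv0 |- *. destruct (excluded_middle_informative (Om z0)) as [HO|HO]; [|lra].
    split; [exact HO|]. revert Hv0. unfold Rmax. destruct (Rle_dec (Cmod (f z0)) M'); lra. }
  destruct (Hloc z0) as [H|H].
  2: { assert (0 < M' - M) as He' by (unfold M'; lra).
       pose proof (locally_singleton _ _ (H _ He') HO0). cbn beta in *. lra. }
  apply (no_interior_max f z0 kappa Hk).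
  { eapply filter_imp; [|exact H]. intros w Hw. apply Hw. }
  eapply filter_imp; [|exact H]. intros w [HOw _].
  specialize (Hmax w (box_of_Cmod _ _ (Rlt_le _ _ (Hbd w HOw)))).
  rewrite Hvf, (HvO w HOw) in Hmax. pose proof (Rmax_l (Cmod (f w)) M'). lra.
Qed.

Lemma pow_beats (a b c : R) : 0 < b -> b < a -> 0 < c -> exists n, b ^ n < a ^ n * c.
Proof.
  intros Hb Hab Hc.
  destruct (pow_lt_1_zero (b / a)) with (y := c) as [n Hn].
  { rewrite Rabs_right by (apply Rle_ge, Rlt_le, Rdiv_lt_0_compat; lra).
    apply Rlt_div_l; lra. }
  { exact Hc. }
  exists n. specialize (Hn n (Nat.le_refl n)).
  rewrite Rabs_right in Hn by (apply Rle_ge, Rlt_le, pow_lt, Rdiv_lt_0_compat; lra).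
  unfold Rdiv in Hn. rewrite Rpow_mult_distr, pow_inv in Hn.
  apply Rlt_div_l in Hn; [lra | apply pow_lt; lra].
Qed.

(** Exceptional boundary points (and infinity) at which [f] is only known to be
    bounded are harmless if some [k] vanishes there: [|f^n k| <= M^n] follows from
    [max_modulus_bounded], and taking [n]-th roots removes [k]. *)
Theorem max_modulus (Om : C -> Prop) (f k : C -> C) (M : R) :
  0 <= M ->
  (forall z, Om z -> 0 < Cmod (k z) <= 1) ->
  (forall z,
     locally z (fun w => Om w /\ ex_Cderive f w /\ ex_Cderive k w) \/
     (forall eps, 0 < eps -> locally z (fun w => Om w -> Cmod (f w) <= M + eps)) \/
     (exists B, locally z (fun w => Om w -> Cmod (f w) <= B) /\
        forall eps, 0 < eps -> locally z (fun w => Om w -> Cmod (k w) <= eps))) ->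
  (exists B, forall eps, 0 < eps -> exists r, forall w, Om w -> r <= Cmod w ->
     Cmod (f w) <= B /\ Cmod (k w) <= eps) ->
  forall z, Om z -> Cmod (f z) <= M.
Proof.
  intros HM Hk Hloc [B Hinf] z Hz.
  apply Rnot_lt_le. intros Hlt.
  set (M' := (M + Cmod (f z)) / 2).
  assert (M < M' /\ M' < Cmod (f z)) as [HM1 HM2] by (unfold M'; lra).
  destruct (pow_beats (Cmod (f z)) M' (Cmod (k z))) as [n Hn]; [lra | lra | apply Hk, Hz |].
  apply (Rlt_not_le _ _ Hn).
  assert (0 < M' ^ n) as Hpos by (apply pow_lt; lra).
  assert (forall b w, Cmod (f w) <= b -> Cmod (k w) <= M' ^ n / (Rabs b ^ n + 1) ->
    Cmod (Cpow (f w) n * k w)%C <= M' ^ n) as Hsmall.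
  { intros b w H1 H2. rewrite Cmod_mult, Cmod_pow.
    pose proof (Rle_abs b). pose proof (Cmod_ge_0 (f w)). pose proof (Cmod_ge_0 (k w)).
    assert (Cmod (f w) ^ n <= Rabs b ^ n) by (apply pow_incr; lra).
    assert (0 <= Cmod (f w) ^ n) by (apply pow_le; lra).
    apply Rle_div_r in H2; [nra|]. lra. }
  assert (forall b, 0 < M' ^ n / (Rabs b ^ n + 1)) as Heps.
  { intros b. apply Rdiv_lt_0_compat; [exact Hpos|].
    assert (0 <= Rabs b ^ n) by (apply pow_le, Rabs_pos). lra. }
  destruct (Hinf _ (Heps B)) as [r Hr].
  set (r' := Rmax (Cmod z + 1) (r + 1)).
  assert (Cmod z < r') by (pose proof (Rmax_l (Cmod z + 1) (r + 1)); unfold r'; lra).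
  assert (r < r') by (pose proof (Rmax_r (Cmod z + 1) (r + 1)); unfold r'; lra).
  rewrite <- Cmod_pow, <- Cmod_mult.
  apply (max_modulus_bounded (fun w => Om w /\ Cmod w < r') (fun w => Cpow (f w) n * k w)%C (M' ^ n) r');
    [now intros w [_ Hw] | | split; [exact Hz | assumption]].
  intros w0.
  destruct (Rlt_le_dec (Cmod w0) r') as [Hw0|Hw0].
  - assert (locally w0 (fun w => Cmod w < r')) as Hnear.
    { eapply filter_imp; [|apply (locally_Cmod_lt (fun w => w) w0 (r' - Cmod w0)); [lra | apply ex_Cderive_id]].
      intros w Hw; cbn beta in Hw; lra. }
    destruct (Hloc w0) as [H1 | [H1 | [b [H1 H2]]]].
    + left. eapply filter_imp; [|apply (filter_and _ _ H1 Hnear)].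
      intros w [[Ho [Hf Hkw]] Hw]. split; [now split|].
      apply ex_Cderive_mult; [now apply ex_Cderive_pow | exact Hkw].
    + right. intros eps He. assert (0 < M' - M) as Hd by lra.
      eapply filter_imp; [|apply (H1 _ Hd)]. intros w Hw [Ho _]. specialize (Hw Ho).
      replace (M + (M' - M)) with M' in Hw by ring. rewrite Cmod_mult, Cmod_pow.
      pose proof (Hk w Ho). pose proof (Cmod_ge_0 (f w)).
      assert (Cmod (f w) ^ n <= M' ^ n) by (apply pow_incr; lra).
      assert (0 <= Cmod (f w) ^ n) by (apply pow_le; lra). nra.
    + right. intros eps He.
      eapply filter_imp; [|apply (filter_and _ _ H1 (H2 _ (Heps b)))]. intros w [A1 A2] [Ho _].
      pose proof (Hsmall b w (A1 Ho) (A2 Ho)). lra.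
  - right. intros eps He.
    assert (locally w0 (fun w => r <= Cmod w)) as Hfar.
    { apply locally_Cmod. exists (r' - r); split; [lra|]. intros w Hw.
      pose proof (Cmod_le_dist w0 w). lra. }
    eapply filter_imp; [|exact Hfar]. intros w Hw [Ho _].
    destruct (Hr w Ho Hw) as [A1 A2]. pose proof (Hsmall B w A1 A2). lra.
Qed.

(** * The Schwarz lemma and Harnack's inequality *)

Lemma locally_Cmod_gt (c z : C) (r : R) :
  r < Cmod (z - c)%C -> locally z (fun w => r < Cmod (w - c)%C).
Proof.
  intros H. apply locally_Cmod. exists (Cmod (z - c)%C - r); split; [lra|].
  intros w Hw. pose proof (Cmod_le_dist (z - c)%C (w - c)%C) as T.
  replace (w - c - (z - c))%C with (w - z)%C in T by ring. lra.
Qed.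

Lemma locally_Cmod_disc (c z : C) (r : R) :
  Cmod (z - c)%C < r -> locally z (fun w => Cmod (w - c)%C < r).
Proof.
  intros H. apply locally_Cmod. exists (r - Cmod (z - c)%C); split; [lra|].
  intros w Hw. pose proof (Cmod_triangle (w - z)%C (z - c)%C) as T.
  replace (w - z + (z - c))%C with (w - c)%C in T by ring. lra.
Qed.

Lemma locally_Im_lt (z : C) (a : R) : Im z < a -> locally z (fun w => Im w < a).
Proof.
  intros H. apply locally_Cmod. exists (a - Im z); split; [lra|].
  intros w Hw. pose proof (im_le_Cmod (w - z)%C) as T.
  pose proof (Rle_abs (Im (w - z)%C)). cbn in *. unfold Im in *. lra.
Qed.

Lemma locally_Im_gt (z : C) (a : R) : a < Im z -> locally z (fun w => a < Im w).
Proof.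
  intros H. apply locally_Cmod. exists (Im z - a); split; [lra|].
  intros w Hw. pose proof (im_le_Cmod (w - z)%C) as T.
  rewrite <- Rabs_Ropp in T.
  pose proof (Rle_abs (- Im (w - z)%C)). cbn in *. unfold Im in *. lra.
Qed.

Lemma Cminus_neq_0 (w p : C) : w <> p -> (w - p)%C <> RtoC 0.
Proof.
  intros H HC. apply H. replace w with ((w - p) + p)%C by ring. rewrite HC. ring.
Qed.

Lemma neq_of_Im (z w : C) : Im z <> Im w -> (z - w)%C <> RtoC 0.
Proof.
  intros H HC. apply H. apply (f_equal Im) in HC. unfold Im in *; cbn in HC. lra.
Qed.

(** [g z / (z - c)] is bounded near [c] and almost bounded by [1/r] near the
    circle. *)
Lemma schwarz (g : C -> C) (c : C) (r : R) :
  0 < r -> (forall z, Cmod (z - c)%C < r -> ex_Cderive g z /\ Cmod (g z) <= 1) ->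
  g c = RtoC 0 -> forall z, Cmod (z - c)%C < r -> Cmod (g z) <= Cmod (z - c)%C / r.
Proof.
  intros Hr Hg H0 z Hz.
  destruct (classic (z = c)) as [->|Hzc].
  { rewrite H0, Cmod_0. apply Rdiv_le_0_compat; [apply Cmod_ge_0 | exact Hr]. }
  assert (RtoC r <> RtoC 0) as Hr0 by (intros HC; apply RtoC_inj in HC; lra).
  pose proof (fun w => Cminus_neq_0 w c) as Hne.
  assert (Cmod (g z * RtoC r / (z - c))%C <= 1) as H.
  { apply (max_modulus (fun w => Cmod (w - c)%C < r /\ w <> c) (fun w => g w * RtoC r / (w - c))%C
      (fun w => (w - c) / RtoC r)%C 1); [lra | | | | now split].
    - intros w [Hw Hwc]. rewrite Cmod_div, Cmod_R, Rabs_right by (assumption || lra).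
      pose proof (proj1 (Cmod_gt_0 _) (Hne w Hwc)).
      split; [apply Rdiv_lt_0_compat; lra | apply Rle_div_l; lra].
    - intros w. destruct (Rtotal_order (Cmod (w - c)%C) r) as [Hw|[Hw|Hw]].
      + destruct (classic (w = c)) as [->|Hwc].
        * right; right. destruct (proj1 (Hg c Hw)) as [l Hl].
          destruct (proj1 (is_Cderive_iff g c l) Hl 1 Rlt_0_1) as [d [Hd Hgd]].
          exists ((1 + Cmod l) * r). split.
          -- apply locally_Cmod. exists d; split; [exact Hd|]. intros w Hwd [_ Hwc].
             specialize (Hgd w Hwd). rewrite H0 in Hgd.
             rewrite Cmod_div, Cmod_mult, Cmod_R, Rabs_right by (now apply Hne || lra).
             pose proof (proj1 (Cmod_gt_0 _) (Hne w Hwc)).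
             apply Rle_div_l; [lra|].
             pose proof (Cmod_triangle (g w - 0 - l * (w - c)) (l * (w - c)))%C as T.
             replace (g w - 0 - l * (w - c) + l * (w - c))%C with (g w) in T by ring.
             rewrite Cmod_mult in T. nra.
          -- intros eps He. apply locally_Cmod. exists (eps * r); split; [nra|].
             intros w Hwd _. rewrite Cmod_div, Cmod_R, Rabs_right by (assumption || lra).
             apply Rle_div_l; lra.
        * left. pose proof (proj1 (Cmod_gt_0 _) (Hne w Hwc)) as Hp.
          eapply filter_imp; [|apply (filter_and _ _ (locally_Cmod_disc c w r Hw) (locally_Cmod_gt c w 0 Hp))].
          intros v [Hv1 Hv2].
          assert (v <> c) as Hvc.
          { intros ->. replace (c - c)%C with (RtoC 0) in Hv2 by ring. rewrite Cmod_0 in Hv2. lra. }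
          repeat split; [exact Hv1 | exact Hvc | |].
          -- apply ex_Cderive_div; [| |now apply Hne].
             ++ apply ex_Cderive_mult; [now apply Hg | apply ex_Cderive_const].
             ++ apply ex_Cderive_minus_const.
          -- apply ex_Cderive_div; [|apply ex_Cderive_const | exact Hr0].
             apply ex_Cderive_minus_const.
      + right; left. intros eps He.
        assert (r / (1 + eps) < Cmod (w - c)%C) as Hq.
        { rewrite Hw. apply Rlt_div_l; nra. }
        eapply filter_imp; [|apply (locally_Cmod_gt c w _ Hq)].
        intros v Hv [Hvr Hvc]. destruct (Hg v Hvr) as [_ Hg1].
        rewrite Cmod_div, Cmod_mult, Cmod_R, Rabs_right by (now apply Hne || lra).
        apply Rlt_div_l in Hv; [|lra]. pose proof (proj1 (Cmod_gt_0 _) (Hne v Hvc)).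
        apply Rle_div_l; [lra|]. nra.
      + right; left. intros eps He.
        eapply filter_imp; [|apply (locally_Cmod_gt c w _ Hw)].
        intros v Hv [Hvr _]. lra.
    - exists 0. intros eps He. exists (Cmod c + r). intros w [Hw _] Hbig.
      pose proof (Cmod_le_dist w c). replace (c - w)%C with (- (w - c))%C in H by ring.
      rewrite Cmod_opp in H. lra. }
  rewrite Cmod_div, Cmod_mult, Cmod_R, Rabs_right in H by (now apply Hne || lra).
  pose proof (proj1 (Cmod_gt_0 _) (Hne z Hzc)).
  apply Rle_div_l in H; [|lra]. apply Rle_div_r; lra.
Qed.

(** By uniform continuity, [f] changes by a factor in the right half-plane between
    consecutive points of a fine subdivision of the radius to [z], the same
    number of points serving for all [z]. Summing the principal logarithms of
    these factors gives an analytic function. *)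
Lemma analytic_log (f : C -> C) (c : C) (r : R) :
  0 < r -> (forall z, Cmod (z - c)%C <= r -> ex_Cderive f z /\ f z <> RtoC 0) ->
  exists L : C -> C, L c = RtoC (ln (Cmod (f c))) /\
    forall z, Cmod (z - c)%C < r -> ex_Cderive L z /\ Re (L z) = ln (Cmod (f z)).
Proof.
  intros Hr Hf.
  destruct (box_uniform (Cmod c + r) (fun d z => Cmod (z - c)%C <= r -> forall z' : C,
     Cmod (z' - c)%C <= r -> Cmod (z' - z)%C < d -> Cmod (f z' - f z)%C < Cmod (f z)))
    as [d [Hd Huc]].
  { intros d d' z Hdd H Hz z' Hz' Hzz. apply H; auto; lra. }
  { intros z _. destruct (Rle_lt_dec (Cmod (z - c)%C) r) as [Hz|Hz].
    - destruct (Hf z Hz) as [Hfz Hnz]. pose proof (proj1 (Cmod_gt_0 _) Hnz) as Hp.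
      destruct (proj1 (locally_Cmod _ _) (ex_Cderive_continuous f z Hfz (Cmod (f z) / 3) ltac:(lra)))
        as [e [He Hce]].
      exists (e / 2); split; [lra|]. apply locally_Cmod. exists (e / 2); split; [lra|].
      intros w Hw _ z' _ Hz'.
      assert (Cmod (f w - f z)%C < Cmod (f z) / 3) as A1 by (apply Hce; lra).
      assert (Cmod (f z' - f z)%C < Cmod (f z) / 3) as A2.
      { apply Hce. pose proof (Cmod_triangle (z' - w)%C (w - z)%C) as T.
        replace (z' - w + (w - z))%C with (z' - z)%C in T by ring. lra. }
      pose proof (Cmod_le_dist (f z) (f w)) as B1.
      pose proof (Cmod_triangle (f z' - f z) (- (f w - f z)))%C as B2. rewrite Cmod_opp in B2.
      replace (f z' - f z + - (f w - f z))%C with (f z' - f w)%C in B2 by ring.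
      lra.
    - exists 1; split; [lra|]. eapply filter_imp; [|apply (locally_Cmod_gt c z r Hz)].
      intros w Hw Hw'. lra. }
  destruct (archimed (r / d)) as [HN _]. set (N := Z.to_nat (up (r / d))).
  assert (0 < r / d) as Hrd by (apply Rdiv_lt_0_compat; lra).
  assert (r / d < INR N) as HN'.
  { unfold N. rewrite INR_IZR_INZ, Z2Nat.id; [exact HN|]. apply le_IZR; lra. }
  assert (0 < INR N) as HN0 by lra.
  apply Rlt_div_l in HN'; [|lra].
  set (p := fun (k : nat) (z : C) => (c + RtoC (INR k / INR N) * (z - c))%C).
  assert (forall k z, (k <= N)%nat -> Cmod (p k z - c)%C <= Cmod (z - c)%C) as Hp.
  { intros k z Hk. unfold p.
    replace (c + RtoC (INR k / INR N) * (z - c) - c)%C with (RtoC (INR k / INR N) * (z - c))%C by ring.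
    rewrite Cmod_mult, Cmod_R. apply le_INR in Hk. pose proof (pos_INR k).
    assert (0 <= INR k / INR N <= 1).
    { split; [apply Rdiv_le_0_compat; lra | apply Rle_div_l; lra]. }
    rewrite Rabs_right by lra. pose proof (Cmod_ge_0 (z - c)%C). nra. }
  assert (forall k z, Cmod (p (S k) z - p k z)%C = Cmod (z - c)%C / INR N) as Hstep.
  { intros k z. unfold p. rewrite S_INR.
    replace (c + RtoC ((INR k + 1) / INR N) * (z - c) - (c + RtoC (INR k / INR N) * (z - c)))%C
      with (RtoC (/ INR N) * (z - c))%C.
    2: { replace ((INR k + 1) / INR N) with (INR k / INR N + / INR N) by (field; lra).
         rewrite RtoC_plus. ring. }
    rewrite Cmod_mult, Cmod_R, Rabs_right by (apply Rle_ge, Rlt_le, Rinv_0_lt_compat; lra).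
    field; lra. }
  set (L := fix L (k : nat) (z : C) : C := match k with
    | O => RtoC (ln (Cmod (f c)))
    | S k => L k z + Clog (f (p (S k) z) / f (p k z)) end%C).
  assert (forall k z, (S k <= N)%nat -> Cmod (z - c)%C <= r -> 0 < Re (f (p (S k) z) / f (p k z))%C) as HRe.
  { intros k z Hk Hz.
    pose proof (Hp k z ltac:(lia)) as P1. pose proof (Hp (S k) z ltac:(lia)) as P2.
    destruct (Hf (p k z) ltac:(lra)) as [_ Hn]. pose proof (proj1 (Cmod_gt_0 _) Hn) as Hpos.
    assert (Cmod (f (p (S k) z) - f (p k z))%C < Cmod (f (p k z))) as A.
    { apply Huc; [| lra | lra |].
      - apply box_of_Cmod. pose proof (Cmod_triangle (p k z - c)%C c) as T.
        replace (p k z - c + c)%C with (p k z) in T by ring. lra.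
      - rewrite Hstep. apply Rlt_div_l; [lra|]. lra. }
    assert (Cmod (f (p (S k) z) / f (p k z) - 1)%C < 1) as B.
    { replace (f (p (S k) z) / f (p k z) - 1)%C with ((f (p (S k) z) - f (p k z)) / f (p k z))%C
        by (field; exact Hn).
      rewrite Cmod_div by exact Hn. apply Rlt_div_l; lra. }
    pose proof (re_le_Cmod (f (p (S k) z) / f (p k z) - 1)%C) as T.
    revert B T. generalize (f (p (S k) z) / f (p k z))%C. intros [a b] B T.
    cbn in T |- *. apply Rabs_le_between in T. unfold Re; cbn. lra. }
  exists (L N). split.
  - assert (forall k, (k <= N)%nat -> L k c = RtoC (ln (Cmod (f c)))) as HL.
    { induction k as [|k IH]; intros Hk; [reflexivity|]. cbn. rewrite IH by lia.
      assert (forall j, p j c = c) as Hpc by (intros j; unfold p; ring).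
      rewrite !Hpc. assert (f c <> RtoC 0) as Hn.
      { apply Hf. replace (c - c)%C with (RtoC 0) by ring. rewrite Cmod_0; lra. }
      replace (f c / f c)%C with (RtoC 1) by (field; exact Hn).
      unfold Clog. rewrite Cmod_1, ln_1. cbn. unfold Rdiv. rewrite Rmult_0_l, atan_0.
      change (0, 0) with (RtoC 0). ring. }
    now apply HL.
  - intros z Hz.
    assert (forall k, (k <= N)%nat -> ex_Cderive (L k) z /\ Re (L k z) = ln (Cmod (f (p k z)))) as HL.
    { induction k as [|k IH]; intros Hk.
      - cbn. split; [apply ex_Cderive_const|]. replace (p O z) with c; [reflexivity|].
        unfold p. cbn [INR]. unfold Rdiv. rewrite Rmult_0_l. ring.
      - destruct (IH ltac:(lia)) as [IH1 IH2].
        pose proof (Hp k z ltac:(lia)) as P1. pose proof (Hp (S k) z ltac:(lia)) as P2.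
        destruct (Hf (p k z) ltac:(lra)) as [Hd1 Hn1].
        destruct (Hf (p (S k) z) ltac:(lra)) as [Hd2 Hn2].
        assert (forall j, ex_Cderive (p j) z) as Hdp.
        { intros j. apply ex_Cderive_plus; [apply ex_Cderive_const|].
          apply ex_Cderive_mult; [apply ex_Cderive_const|].
          apply ex_Cderive_minus_const. }
        split.
        + apply (ex_Cderive_plus (L k)); [exact IH1|].
          apply (ex_Cderive_comp Clog); [apply ex_Cderive_Clog, HRe; [lia | lra]|].
          apply ex_Cderive_div; [| |exact Hn1]; now apply (ex_Cderive_comp f).
        + change (L (S k) z) with (L k z + Clog (f (p (S k) z) / f (p k z)))%C.
          replace (Re (L k z + Clog (f (p (S k) z) / f (p k z)))%C)
            with (Re (L k z) + Re (Clog (f (p (S k) z) / f (p k z)))%C) by reflexivity.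
          rewrite IH2, Re_Clog, Cmod_div by exact Hn1.
          pose proof (proj1 (Cmod_gt_0 _) Hn1). pose proof (proj1 (Cmod_gt_0 _) Hn2).
          rewrite ln_div by assumption. ring. }
    destruct (HL N (Nat.le_refl N)) as [A B]. split; [exact A|].
    rewrite B. do 3 f_equal. unfold p. replace (INR N / INR N) with 1 by (field; lra). ring.
Qed.

(** A disc of pseudo-hyperbolic radius [rho] around [a] in the right half-plane
    projects onto a segment of the real axis. *)
Lemma cayley_bound (w : C) (a rho : R) :
  0 < a -> 0 <= rho < 1 -> 0 < Re w -> Cmod (w - RtoC a)%C <= rho * Cmod (w + RtoC a)%C ->
  (1 - rho) * a <= (1 + rho) * Re w /\ (1 - rho) * Re w <= (1 + rho) * a.
Proof.
  intros Ha Hrho Hw H.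
  destruct w as [x y]; cbn [Re fst] in *.
  assert (((x - a) ^ 2 + y ^ 2) <= rho ^ 2 * ((x + a) ^ 2 + y ^ 2)) as Hsq.
  { assert (Cmod ((x, y) - RtoC a)%C ^ 2 <= rho ^ 2 * Cmod ((x, y) + RtoC a)%C ^ 2) as H2.
    { rewrite <- Rpow_mult_distr. apply pow_incr. split; [apply Cmod_ge_0 | exact H]. }
    rewrite !Cmod2_alt in H2. cbn in H2 |- *. ring_simplify in H2. ring_simplify. lra. }
  assert ((x - a) ^ 2 <= (rho * (x + a)) ^ 2) as H1.
  { assert (0 <= (1 - rho ^ 2) * y ^ 2); [|nra].
    apply Rmult_le_pos; [nra | apply pow2_ge_0]. }
  assert (0 <= rho * (x + a)) as H0 by (apply Rmult_le_pos; lra).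
  assert (Rabs (x - a) <= rho * (x + a)) as H2.
  { rewrite <- (Rabs_right (rho * (x + a))) by lra.
    apply Rsqr_le_abs_0. unfold Rsqr. nra. }
  apply Rabs_le_between in H2. lra.
Qed.

(** The positive harmonic function [- ln |f|] is the real part of an analytic
    function with values in the right half-plane; the Schwarz lemma applies to its
    Cayley transform. *)
Lemma harnack (f : C -> C) (c : C) (r : R) :
  0 < r ->
  (forall z, Cmod (z - c)%C <= r -> ex_Cderive f z /\ f z <> RtoC 0 /\ Cmod (f z) <= 1) ->
  forall z rho, Cmod (z - c)%C <= rho * r -> rho < 1 ->
  (1 - rho) * - ln (Cmod (f c)) <= (1 + rho) * - ln (Cmod (f z)) /\
  (1 - rho) * - ln (Cmod (f z)) <= (1 + rho) * - ln (Cmod (f c)).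
Proof.
  intros Hr Hf z rho Hz Hrho.
  assert (0 <= rho) as Hrho0 by (pose proof (Cmod_ge_0 (z - c)%C); nra).
  destruct (analytic_log f c r Hr) as [L [HLc HL]].
  { intros w Hw; split; now apply Hf. }
  assert (forall w, Cmod (w - c)%C < r -> 0 <= - Re (L w)) as Hpos.
  { intros w Hw. destruct (HL w Hw) as [_ ->]. destruct (Hf w ltac:(lra)) as (_ & H1 & H2).
    apply Cmod_gt_0 in H1. pose proof (ln_le _ _ H1 H2). rewrite ln_1 in *. lra. }
  assert (Cmod (c - c)%C < r) as Hcr by (replace (c - c)%C with (RtoC 0) by ring; now rewrite Cmod_0).
  assert (Cmod (z - c)%C < r) as Hzr by nra.
  (* [- ln |f|] may vanish; adding [eps] makes it positive. *)
  enough (forall eps, 0 < eps ->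
    (1 - rho) * (- ln (Cmod (f c)) + eps) <= (1 + rho) * (- ln (Cmod (f z)) + eps) /\
    (1 - rho) * (- ln (Cmod (f z)) + eps) <= (1 + rho) * (- ln (Cmod (f c)) + eps)) as H.
  { split; apply le_epsilon; intros e He; specialize (H (e / 2) ltac:(lra)); nra. }
  intros eps He.
  set (a := - ln (Cmod (f c)) + eps).
  assert (0 < a) as Ha.
  { specialize (Hpos c Hcr). rewrite HLc in Hpos. unfold a. unfold Re in Hpos; cbn in Hpos. lra. }
  set (W := fun w => (RtoC eps - L w)%C).
  assert (forall w, Re (W w) = eps - Re (L w)) as HRW by (intros w; unfold W, Re; cbn; lra).
  assert (forall w, Cmod (w - c)%C < r -> (W w + RtoC a)%C <> RtoC 0) as Hne.
  { intros w Hw HC. apply (f_equal Re) in HC.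
    replace (Re (W w + RtoC a)%C) with (Re (W w) + a) in HC by reflexivity.
    rewrite HRW in HC. specialize (Hpos w Hw). unfold Re in *; cbn in *. lra. }
  assert (Cmod ((W z - RtoC a) / (W z + RtoC a))%C <= Cmod (z - c)%C / r) as HS.
  { apply (schwarz (fun w => (W w - RtoC a) / (W w + RtoC a))%C c r Hr); [| |exact Hzr].
    - intros w Hw. assert (ex_Cderive W w) as HW.
      { apply ex_Cderive_minus; [apply ex_Cderive_const | now apply HL]. }
      split.
      + apply ex_Cderive_div; [| |now apply Hne].
        * apply ex_Cderive_minus; [exact HW | apply ex_Cderive_const].
        * apply ex_Cderive_plus; [exact HW | apply ex_Cderive_const].
      + rewrite Cmod_div by now apply Hne.
        pose proof (proj1 (Cmod_gt_0 _) (Hne w Hw)) as Hp.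
        apply Rle_div_l; [lra|]. rewrite Rmult_1_l.
        pose proof (HRW w) as E. specialize (Hpos w Hw).
        destruct (W w) as [x y]. cbn [Re fst] in E.
        unfold Cmod. apply sqrt_le_1_alt. cbn. nra.
    - unfold W. rewrite HLc, <- RtoC_minus, <- RtoC_minus.
      replace (eps - ln (Cmod (f c)) - a) with 0 by (unfold a; ring).
      unfold Cdiv. ring. }
  rewrite Cmod_div in HS by now apply Hne.
  pose proof (proj1 (Cmod_gt_0 _) (Hne z Hzr)) as Hp.
  apply (proj1 (Rle_div_l _ _ _ (Rlt_gt _ _ Hp))) in HS.
  assert (Cmod (z - c)%C / r <= rho) as Hq by (apply Rle_div_l; lra).
  destruct (HL z Hzr) as [_ HLz].
  destruct (cayley_bound (W z) a rho Ha ltac:(lra)) as [A B].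
  - rewrite HRW. specialize (Hpos z Hzr). lra.
  - nra.
  - rewrite HRW, HLz in A, B. split; lra.
Qed.

(** * Half-plane principles and barriers *)

Lemma conj_dist_le (w p : C) : 0 < Im w -> 0 < Im p -> Cmod (w - p)%C <= Cmod (w - Cconj p)%C.
Proof.
  destruct w as [a b], p as [c d]. cbn [Im snd]. intros Hb Hd.
  unfold Cmod. apply sqrt_le_1_alt. cbn. nra.
Qed.

Lemma conj_dist_ge (w p : C) : 0 < Im w -> 0 < Im p -> Im p < Cmod (w - Cconj p)%C.
Proof.
  intros Hw Hp. pose proof (im_le_Cmod (w - Cconj p)%C) as T.
  pose proof (Rle_abs (Im (w - Cconj p)%C)).
  destruct w, p; cbn in *. unfold Im in *; cbn in *. lra.
Qed.

(** Boundedness replaces control at infinity, and also at one puncture [p]: the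
    auxiliary factor of [max_modulus] is the Blaschke factor of [p] divided by
    [w + i], which vanishes at both. *)
Lemma phragmen_lindelof (g : C -> C) (p : C) :
  0 < Im p ->
  (forall z, 0 < Im z -> z <> p -> ex_Cderive g z) ->
  (exists B, forall z, 0 < Im z -> z <> p -> Cmod (g z) <= B) ->
  (forall x eps, 0 < eps -> locally (RtoC x) (fun w => 0 < Im w -> w <> p -> Cmod (g w) <= 1 + eps)) ->
  forall z, 0 < Im z -> z <> p -> Cmod (g z) <= 1.
Proof.
  intros Hp Hg [B HB] Hreal z Hz Hzp.
  assert (forall w, 0 < Im w -> 1 < Cmod (w + Ci)%C) as Hi1.
  { intros w Hw. pose proof (im_le_Cmod (w + Ci)%C). pose proof (Rle_abs (Im (w + Ci)%C)).
    replace (Im (w + Ci)%C) with (Im w + 1) in * by reflexivity. lra. }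
  assert (forall w, 0 < Im w -> (w - Cconj p)%C <> RtoC 0) as Hq0.
  { intros w Hw. apply Cmod_gt_0. pose proof (conj_dist_ge w p Hw Hp). lra. }
  assert (forall w, 0 < Im w -> (w + Ci)%C <> RtoC 0) as Hi0.
  { intros w Hw. apply Cmod_gt_0. pose proof (Hi1 w Hw). lra. }
  set (k := fun w => ((w - p) / (w - Cconj p) / (w + Ci))%C).
  assert (forall w, 0 < Im w -> Cmod (k w) = Cmod (w - p)%C / Cmod (w - Cconj p)%C / Cmod (w + Ci)%C) as Hkm.
  { intros w Hw. unfold k. now rewrite !Cmod_div by auto. }
  assert (forall w, 0 < Im w -> Cmod (k w) <= / Cmod (w + Ci)%C) as Hk1.
  { intros w Hw. rewrite Hkm by exact Hw. pose proof (conj_dist_ge w p Hw Hp).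
    pose proof (Hi1 w Hw). rewrite <- (Rmult_1_l (/ Cmod (w + Ci)%C)).
    apply Rmult_le_compat_r; [left; apply Rinv_0_lt_compat; lra|].
    apply Rle_div_l; [lra|]. pose proof (conj_dist_le w p Hw Hp). lra. }
  apply (max_modulus (fun w => 0 < Im w /\ w <> p) g k 1); [lra | | | | now split].
  - intros w [Hw Hwp]. split.
    + rewrite Hkm by exact Hw. pose proof (proj1 (Cmod_gt_0 _) (Cminus_neq_0 w p Hwp)).
      pose proof (conj_dist_ge w p Hw Hp). pose proof (Hi1 w Hw).
      apply Rdiv_lt_0_compat; [apply Rdiv_lt_0_compat|]; lra.
    + eapply Rle_trans; [now apply Hk1|]. rewrite <- Rinv_1.
      apply Rinv_le_contravar; [lra|]. pose proof (Hi1 w Hw); lra.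
  - intros w. destruct (Rtotal_order (Im w) 0) as [Hi|[Hi|Hi]].
    + right; left. intros eps He. eapply filter_imp; [|apply (locally_Im_lt w 0 Hi)]. intros v Hv [Hv' _]. lra.
    + right; left. intros eps He.
      replace w with (RtoC (Re w)) by (destruct w; apply injective_projections; cbn in *; congruence).
      eapply filter_imp; [|apply (Hreal (Re w) eps He)]. intros v Hv [A1 A2]. auto.
    + destruct (classic (w = p)) as [->|Hwp].
      * right; right. exists B. split.
        { apply filter_forall. intros v [A1 A2]; auto. }
        intros eps He. apply locally_Cmod. exists (eps * Im p).
        split; [apply Rmult_lt_0_compat; lra|].
        intros v Hv [Hvi _]. rewrite Hkm by exact Hvi.
        pose proof (conj_dist_ge v p Hvi Hp). pose proof (Hi1 v Hvi). pose proof (Cmod_ge_0 (v - p)%C).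
        apply Rle_div_l; [lra|]. apply Rle_div_l; [lra|].
        apply Rle_trans with (eps * 1 * Im p); [lra|].
        apply Rmult_le_compat; try lra. apply Rmult_le_compat_l; lra.
      * left. pose proof (proj1 (Cmod_gt_0 _) (Cminus_neq_0 w p Hwp)) as Hwp'.
        eapply filter_imp; [|apply (filter_and _ _ (locally_Im_gt w 0 Hi) (locally_Cmod_gt p w 0 Hwp'))].
        intros v [Hv1 Hv2].
        assert (v <> p) as Hvp.
        { intros ->. replace (p - p)%C with (RtoC 0) in Hv2 by ring. rewrite Cmod_0 in Hv2. lra. }
        split; [now split | split; [now apply Hg |]]. unfold k.
        apply ex_Cderive_div; [apply ex_Cderive_div; [| | now apply Hq0] | | now apply Hi0].
        -- apply ex_Cderive_minus_const.
        -- apply ex_Cderive_minus_const.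
        -- apply ex_Cderive_plus_const.
  - exists B. intros eps He. exists (1 + / eps). intros w [Hw Hwp] Hbig. split; [now apply HB|].
    eapply Rle_trans; [now apply Hk1|]. rewrite <- (Rinv_inv eps).
    apply Rinv_le_contravar; [now apply Rinv_0_lt_compat|].
    pose proof (Cmod_triangle (w + Ci)%C (- Ci)%C) as T.
    replace (w + Ci + - Ci)%C with w in T by ring. rewrite Cmod_opp, Cmod_Ci in T. lra.
Qed.

(** Dividing [f] by the Blaschke factor of its zero [p] leaves the bound [1]: the
    quotient is bounded near [p] because [f] is differentiable there, and the
    Blaschke factor is unimodular on the line. *)
Lemma schwarz_pick (f : C -> C) (p : C) :
  (forall z, 0 <= Im z -> ex_Cderive f z /\ Cmod (f z) <= 1) ->
  0 < Im p -> f p = RtoC 0 ->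
  forall z, 0 < Im z -> Cmod (f z) * Cmod (z - Cconj p)%C <= Cmod (z - p)%C.
Proof.
  intros Hf Hp Hfp z Hz.
  destruct (classic (z = p)) as [->|Hzp].
  { rewrite Hfp, Cmod_0, Rmult_0_l. apply Cmod_ge_0. }
  set (g := fun w => (f w * (w - Cconj p) / (w - p))%C).
  assert (forall w, w <> p -> Cmod (g w) = Cmod (f w) * Cmod (w - Cconj p)%C / Cmod (w - p)%C) as Hgm.
  { intros w Hw. unfold g. rewrite Cmod_div by now apply Cminus_neq_0. now rewrite Cmod_mult. }
  assert (Cmod (g z) <= 1) as H.
  { apply (phragmen_lindelof g p Hp); [| | | exact Hz | exact Hzp].
    - intros w Hw Hwp. apply ex_Cderive_div; [| |now apply Cminus_neq_0].
      + apply ex_Cderive_mult; [apply Hf; lra|].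
        apply ex_Cderive_minus_const.
      + apply ex_Cderive_minus_const.
    - destruct (proj1 (Hf p ltac:(lra))) as [l Hl].
      destruct (proj1 (is_Cderive_iff f p l) Hl 1 Rlt_0_1) as [d [Hd Hfd]].
      exists ((1 + Cmod l) * (d + 2 * Im p) + (1 + 2 * Im p / d)).
      intros w Hw Hwp. rewrite Hgm by exact Hwp.
      pose proof (proj1 (Cmod_gt_0 _) (Cminus_neq_0 w p Hwp)) as Hpos.
      assert (Cmod (w - Cconj p)%C <= Cmod (w - p)%C + 2 * Im p) as Hcc.
      { pose proof (Cmod_triangle (w - p)%C (p - Cconj p)%C) as T.
        replace (w - p + (p - Cconj p))%C with (w - Cconj p)%C in T by ring.
        replace (p - Cconj p)%C with (Ci * RtoC (2 * Im p))%C in T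
          by (destruct p; apply injective_projections; unfold Im; cbn; ring).
        rewrite Cmod_mult, Cmod_Ci, Cmod_R, Rabs_right in T by lra. lra. }
      pose proof (Cmod_ge_0 l). pose proof (Cmod_ge_0 (f w)).
      assert (0 < 2 * Im p / d) by (apply Rdiv_lt_0_compat; lra).
      pose proof (Cmod_ge_0 (w - Cconj p)%C).
      destruct (Rlt_le_dec (Cmod (w - p)%C) d) as [Hwd|Hwd].
      + specialize (Hfd w Hwd). rewrite Hfp in Hfd.
        pose proof (Cmod_triangle (f w - 0 - l * (w - p)) (l * (w - p)))%C as T.
        replace (f w - 0 - l * (w - p) + l * (w - p))%C with (f w) in T by ring.
        rewrite Cmod_mult in T.
        apply Rle_div_l; [lra|].
        apply Rle_trans with ((1 + Cmod l) * Cmod (w - p)%C * (d + 2 * Im p)).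
        * apply Rmult_le_compat; lra.
        * assert (0 <= (1 + 2 * Im p / d) * Cmod (w - p)%C) by (apply Rmult_le_pos; lra). lra.
      + destruct (Hf w ltac:(lra)) as [_ Hf1].
        assert (0 <= (1 + Cmod l) * (d + 2 * Im p)) by (apply Rmult_le_pos; lra).
        assert (2 * Im p <= 2 * Im p / d * Cmod (w - p)%C).
        { apply Rle_trans with (2 * Im p / d * d); [apply Req_le; field; lra|].
          apply Rmult_le_compat_l; lra. }
        apply Rle_div_l; [lra|].
        apply Rle_trans with (1 * Cmod (w - Cconj p)%C); [apply Rmult_le_compat_r; lra|].
        assert (0 <= (1 + Cmod l) * (d + 2 * Im p) * Cmod (w - p)%C) by (apply Rmult_le_pos; lra). lra.
    - intros x eps He.
      assert ((RtoC x - p)%C <> RtoC 0) as Hxp.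
      { apply neq_of_Im. cbn [Im snd RtoC]. unfold Im in *; cbn; lra. }
      eapply filter_imp; [|apply (locally_Cmod_lt (fun w => (w - Cconj p) / (w - p))%C (RtoC x) eps He)].
      + intros w Hw Hwi Hwp. cbn beta in Hw. rewrite Hgm by exact Hwp.
        rewrite !Cmod_div in Hw by (assumption || now apply Cminus_neq_0).
        assert (Cmod (RtoC x - Cconj p)%C = Cmod (RtoC x - p)%C) as E.
        { destruct p as [a b]. unfold Cmod; cbn. f_equal. ring. }
        rewrite E in Hw. rewrite (Rdiv_diag (Cmod (RtoC x - p)%C)) in Hw
          by (apply Rgt_not_eq; now apply Cmod_gt_0).
        destruct (Hf w ltac:(lra)) as [_ Hf1]. pose proof (Cmod_ge_0 (f w)).
        unfold Rdiv in *. rewrite Rmult_assoc.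
        assert (0 <= Cmod (w - Cconj p)%C * / Cmod (w - p)%C).
        { apply Rmult_le_pos; [apply Cmod_ge_0|]. left; apply Rinv_0_lt_compat. now apply Cmod_gt_0, Cminus_neq_0. }
        nra.
      + apply ex_Cderive_div; [| |exact Hxp];
        (apply ex_Cderive_minus_const). }
  rewrite Hgm in H by exact Hzp.
  pose proof (proj1 (Cmod_gt_0 _) (Cminus_neq_0 z p Hzp)) as Hpos.
  apply (proj1 (Rle_div_l _ _ _ (Rlt_gt _ _ Hpos))) in H. lra.
Qed.

Lemma Im_opp_inv (x y : R) : x ^ 2 + y ^ 2 <> 0 -> Im (- / (x, y))%C = y / (x ^ 2 + y ^ 2).
Proof. intros H. unfold Im, Cinv; cbn in *. field. contradict H. rewrite <- H. ring. Qed.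

(** A boundary Harnack inequality. The harmonic function
    [h z = y / |z - (xi + r)|^2 + y / |z - (xi - r)|^2] vanishes on the diameter
    and equals [1 / y] on the semicircle [|z - xi| = r]. So the interior bound
    [- ln |f| <= K / y], which degenerates at the line, improves to
    [- ln |f| <= K h] in the half-disc; at the corners, where [h] is singular,
    positivity of [h] is enough. *)
Lemma halfdisc_bound (f : C -> C) (xi r K : R) :
  0 < r -> 0 <= K ->
  (forall z, Cmod (z - RtoC xi)%C <= r -> 0 <= Im z -> ex_Cderive f z /\ f z <> RtoC 0) ->
  (forall x, Rabs (x - xi) <= r -> Cmod (f (RtoC x)) = 1) ->
  (forall z, Cmod (z - RtoC xi)%C <= r -> 0 < Im z -> exp (- (K / Im z)) <= Cmod (f z)) ->
  forall y, 0 < y < r -> exp (- (2 * K / r ^ 2 * y)) <= Cmod (f (xi, y)).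
Proof.
  intros Hr HK Hf Hreal Hlow y Hy.
  set (zeta := fun z : C => (- / (z - RtoC (xi + r)) + - / (z - RtoC (xi - r)))%C).
  set (h := fun z : C => Im z / ((Re z - (xi + r)) ^ 2 + Im z ^ 2) + Im z / ((Re z - (xi - r)) ^ 2 + Im z ^ 2)).
  set (F := fun z : C => (Cexp (Ci * (RtoC K * zeta z)) / f z)%C).
  assert (forall z, 0 < Im z -> Im (zeta z) = h z) as Hzh.
  { intros [a b] Hb; cbn [Im snd] in Hb. unfold zeta, h.
    replace ((a, b) - RtoC (xi + r))%C with ((a - (xi + r), b) : C)
      by (apply injective_projections; cbn; ring).
    replace ((a, b) - RtoC (xi - r))%C with ((a - (xi - r), b) : C)
      by (apply injective_projections; cbn; ring).
    assert (forall u v : C, Im (u + v)%C = Im u + Im v) as Hadd by (intros; reflexivity).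
    assert (forall c, c ^ 2 + b ^ 2 <> 0) as Hn.
    { intros c. pose proof (pow2_ge_0 c). assert (0 < b ^ 2) by (apply pow_lt; lra). lra. }
    now rewrite Hadd, !Im_opp_inv by apply Hn. }
  assert (forall z, 0 < Im z -> 0 <= h z) as Hh0.
  { intros z Hz. unfold h. 
    assert (0 < Im z ^ 2) by (apply pow_lt; lra).
    pose proof (pow2_ge_0 (Re z - (xi + r))). pose proof (pow2_ge_0 (Re z - (xi - r))).
    apply Rplus_le_le_0_compat; apply Rdiv_le_0_compat; lra. }
  assert (forall z, Cmod (z - RtoC xi)%C <= r -> 0 < Im z -> Cmod (F z) = exp (- (K * h z)) / Cmod (f z)) as HF.
  { intros z Hz Hi. unfold F. rewrite Cmod_div by (apply Hf; [exact Hz | lra]).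
    rewrite Cmod_Cexp. do 2 f_equal. rewrite <- Hzh by exact Hi. unfold Re, Im; cbn. ring. }
  assert (forall z, Cmod (z - RtoC xi)%C <= r -> 0 < Im z -> ex_Cderive F z) as HFd.
  { intros z Hz Hi. unfold F. apply ex_Cderive_div; [| apply Hf; [exact Hz | lra] ..].
    apply (ex_Cderive_comp Cexp); [apply ex_Cderive_Cexp|].
    apply ex_Cderive_mult; [apply ex_Cderive_const|].
    apply ex_Cderive_mult; [apply ex_Cderive_const|].
    unfold zeta. apply ex_Cderive_plus; apply ex_Cderive_opp;
    apply (ex_Cderive_comp Cinv (fun z => z - _)%C);
    (apply ex_Cderive_inv, neq_of_Im; cbn [Im snd RtoC]; unfold Im in *; cbn; lra) ||
    (apply ex_Cderive_minus_const). }
  assert (Cmod (F (xi, y)) <= 1) as Hmain.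
  { assert (Cmod ((xi, y) - RtoC xi)%C = y) as Hxy.
    { replace ((xi, y) - RtoC xi)%C with (Ci * RtoC y)%C by (apply injective_projections; cbn; ring).
      rewrite Cmod_mult, Cmod_Ci, Cmod_R, Rabs_right; lra. }
    apply (max_modulus_bounded (fun z => Cmod (z - RtoC xi)%C < r /\ 0 < Im z) F 1 (Rabs xi + r)).
    - intros z [Hz _]. pose proof (Cmod_triangle (z - RtoC xi)%C (RtoC xi)) as T.
      replace (z - RtoC xi + RtoC xi)%C with z in T by ring. rewrite Cmod_R in T. lra.
    - intros z.
      destruct (Rtotal_order (Im z) 0) as [Hi|[Hi|Hi]].
      + right. intros eps He. eapply filter_imp; [|apply (locally_Im_lt z 0 Hi)]. intros w Hw [_ Hw']. lra.
      + destruct (Rlt_le_dec r (Cmod (z - RtoC xi)%C)) as [Hz|Hz].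
        { right. intros eps He. eapply filter_imp; [|apply (locally_Cmod_gt _ z r Hz)].
          intros w Hw [Hw' _]. lra. }
        right. intros eps He.
        destruct (Hf z Hz ltac:(lra)) as [Hfd _].
        assert (Cmod (f z) = 1) as Hfz.
        { replace z with (RtoC (Re z)) in Hz |- * by (destruct z; apply injective_projections; cbn in *; congruence).
          apply Hreal. rewrite <- RtoC_minus, Cmod_R in Hz. exact Hz. }
        eapply filter_imp; [|apply (ex_Cderive_continuous f z Hfd (eps / (1 + eps)))].
        2: { apply Rdiv_lt_0_compat; lra. }
        intros w Hw [Hwr Hwi]. cbn beta in Hw. rewrite HF by lra.
        assert (/ (1 + eps) <= Cmod (f w)) as Hfw.
        { pose proof (Cmod_le_dist (f z) (f w)). rewrite Hfz in *.
          replace (/ (1 + eps)) with (1 - eps / (1 + eps)) by (field; lra). lra. }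
        assert (0 < / (1 + eps)) by (apply Rinv_0_lt_compat; lra).
        apply Rle_div_l; [lra|].
        apply Rle_trans with 1.
        * rewrite <- exp_0. apply exp_le_compat. specialize (Hh0 w Hwi). nra.
        * apply Rle_trans with ((1 + eps) * / (1 + eps)); [rewrite Rinv_r by lra; lra|].
          apply Rmult_le_compat_l; lra.
      + destruct (Rtotal_order (Cmod (z - RtoC xi)%C) r) as [Hz|[Hz|Hz]].
        * left. eapply filter_imp; [|apply (filter_and _ _ (locally_Cmod_disc _ z r Hz) (locally_Im_gt z 0 Hi))].
          intros w [Hw1 Hw2]. repeat split; auto. apply HFd; lra.
        * right. intros eps He.
          eapply filter_imp; [|apply (locally_Cmod_lt F z eps He (HFd z (Req_le _ _ Hz) Hi))].
          intros w Hw _. cbn beta in Hw.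
          enough (Cmod (F z) <= 1) by lra.
          rewrite HF by lra.
          assert (h z = / Im z) as Hhz.
          { assert ((Re z - xi) ^ 2 + Im z ^ 2 = r ^ 2) as Hq.
            { rewrite <- Hz, Cmod2_alt. destruct z; cbn; ring. }
            unfold h. set (a := Re z - xi) in *. set (b := Im z) in *.
            replace (Re z - (xi + r)) with (a - r) by (unfold a; ring).
            replace (Re z - (xi - r)) with (a + r) by (unfold a; ring).
            assert (r + a <> 0) by nra. assert (r - a <> 0) by nra.
            replace ((a - r) ^ 2 + b ^ 2) with (2 * r * (r - a)) by (ring_simplify; nra).
            replace ((a + r) ^ 2 + b ^ 2) with (2 * r * (r + a)) by (ring_simplify; nra).
            transitivity (b / (r ^ 2 - a ^ 2)); [field; repeat split; try lra; nra|].
            replace (r ^ 2 - a ^ 2) with (b * b) by nra. field. lra. }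
          rewrite Hhz. destruct (Hf z (Req_le _ _ Hz) (Rlt_le _ _ Hi)) as [_ Hn].
          apply Cmod_gt_0 in Hn. apply Rle_div_l; [lra|].
          rewrite Rmult_1_l. apply Hlow; lra.
        * right. intros eps He. eapply filter_imp; [|apply (locally_Cmod_gt _ z r Hz)].
          intros w Hw [Hw' _]. lra.
    - rewrite Hxy. cbn [Im snd]. lra. }
  rewrite HF in Hmain.
  2: { replace ((xi, y) - RtoC xi)%C with (Ci * RtoC y)%C by (apply injective_projections; cbn; ring).
      rewrite Cmod_mult, Cmod_Ci, Cmod_R, Rabs_right; lra. }
  2: { cbn; lra. }
  destruct (Hf (xi, y)) as [_ Hn].
  { replace ((xi, y) - RtoC xi)%C with (Ci * RtoC y)%C by (apply injective_projections; cbn; ring).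
      rewrite Cmod_mult, Cmod_Ci, Cmod_R, Rabs_right; lra. }
  { cbn; lra. }
  apply Cmod_gt_0 in Hn.
  apply Rle_div_l in Hmain; [|lra]. rewrite Rmult_1_l in Hmain.
  eapply Rle_trans; [|exact Hmain]. apply exp_le_compat, Ropp_le_contravar.
  replace (2 * K / r ^ 2 * y) with (K * (2 * y / r ^ 2)) by (field; lra).
  apply Rmult_le_compat_l; [exact HK|]. unfold h; cbn [Re Im fst snd].
  replace (xi - (xi + r)) with (- r) by ring. replace (xi - (xi - r)) with r by ring.
  replace ((- r) ^ 2) with (r ^ 2) by ring.
  replace (2 * y / r ^ 2) with (y / r ^ 2 + y / r ^ 2) by (field; lra).
  assert (0 < r ^ 2) by (apply pow_lt; lra).
  assert (y / (r ^ 2 + y ^ 2) <= y / r ^ 2).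
  { apply Rmult_le_compat_l; [lra|]. apply Rinv_le_contravar; [lra|]. pose proof (pow2_ge_0 y). lra. }
  lra.
Qed.

Lemma atan_diff (p q : R) : p < q -> exists t, p < t < q /\ atan q - atan p = (q - p) / (1 + t ^ 2).
Proof.
  intros H.
  destruct (MVT_cor2 atan (fun t => / (1 + t ^ 2)) p q H) as [t [E Ht]].
  { intros; apply derivable_pt_lim_atan. }
  exists t; split; [exact Ht|]. rewrite E. unfold Rdiv. ring.
Qed.

(** The angle under which [[a, b]] is seen from [z] in the upper half-plane, that
    is, [PI] times the harmonic measure of this segment. *)
Definition angle (a b : R) (z : C) : R := atan ((b - Re z) / Im z) - atan ((a - Re z) / Im z).

Lemma angle_lower (a b : R) (z : C) :
  0 < Im z -> Re z < a -> a < b ->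
  (b - a) * Im z / (Im z ^ 2 + (b - Re z) ^ 2) <= angle a b z.
Proof.
  intros Hi Ha Hab. unfold angle. destruct z as [x y]; cbn [Re Im fst snd] in *.
  destruct (atan_diff ((a - x) / y) ((b - x) / y)) as [t [Ht ->]].
  { apply Rmult_lt_compat_r; [now apply Rinv_0_lt_compat | lra]. }
  assert (0 < (a - x) / y) by (apply Rdiv_lt_0_compat; lra).
  assert (t ^ 2 <= ((b - x) / y) ^ 2) by (apply pow_incr; lra).
  replace ((b - a) * y / (y ^ 2 + (b - x) ^ 2)) with (((b - x) / y - (a - x) / y) / (1 + ((b - x) / y) ^ 2)).
  2: { field. split; [nra | lra]. }
  apply Rmult_le_compat_l.
  - replace ((b - x) / y - (a - x) / y) with ((b - a) / y) by (field; lra).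
    apply Rlt_le, Rdiv_lt_0_compat; lra.
  - apply Rinv_le_contravar; [pose proof (pow2_ge_0 t)|]; lra.
Qed.

Lemma angle_upper (a b d : R) (z : C) :
  0 < Im z -> a < b -> 0 < d -> Re z <= a - d \/ b + d <= Re z ->
  angle a b z <= (b - a) * Im z / d ^ 2.
Proof.
  intros Hi Hab Hd Hz. unfold angle. destruct z as [x y]; cbn [Re Im fst snd] in *.
  destruct (atan_diff ((a - x) / y) ((b - x) / y)) as [t [Ht ->]].
  { apply Rmult_lt_compat_r; [now apply Rinv_0_lt_compat | lra]. }
  assert ((d / y) ^ 2 <= t ^ 2) as Ht2.
  { assert (0 < d / y) by (apply Rdiv_lt_0_compat; lra).
    destruct Hz as [Hz|Hz].
    - assert (d / y <= (a - x) / y).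
      { apply Rmult_le_compat_r; [left; now apply Rinv_0_lt_compat | lra]. }
      apply pow_incr; lra.
    - assert ((b - x) / y <= - (d / y)).
      { replace (- (d / y)) with ((- d) / y) by (field; lra).
        apply Rmult_le_compat_r; [left; now apply Rinv_0_lt_compat | lra]. }
      replace (t ^ 2) with ((- t) ^ 2) by ring. apply pow_incr; lra. }
  replace ((b - x) / y - (a - x) / y) with ((b - a) / y) by (field; lra).
  replace ((b - a) * y / d ^ 2) with ((b - a) / y / (d / y) ^ 2) by (field; lra).
  apply Rmult_le_compat_l; [apply Rlt_le, Rdiv_lt_0_compat; lra|].
  apply Rinv_le_contravar; [|lra]. apply pow_lt, Rdiv_lt_0_compat; lra.
Qed.

Lemma angle_le_PI (a b : R) (z : C) : angle a b z <= PI.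
Proof.
  unfold angle. pose proof (atan_bound ((b - Re z) / Im z)). pose proof (atan_bound ((a - Re z) / Im z)). lra.
Qed.

(** The function [- ln |g|] is superharmonic, whatever the zeros of [g], so it
    dominates the harmonic function [kappa * angle a b] as soon as it does on the
    line. The comparison is that of [|g exp (kappa * angle)|] with [1]. *)
Lemma angle_bound (g : C -> C) (a b kappa : R) :
  a < b -> 0 < kappa ->
  (forall z, 0 <= Im z -> ex_Cderive g z /\ Cmod (g z) <= 1) ->
  (forall x, a <= x <= b -> Cmod (g (RtoC x)) <= exp (- (kappa * PI))) ->
  forall z, 0 < Im z -> Cmod (g z) <= exp (- (kappa * angle a b z)).
Proof.
  intros Hab Hk Hg Hlow z Hz.
  set (Lam := fun z : C => (Clog (- Ci * (z - RtoC b)) - Clog (- Ci * (z - RtoC a)))%C).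
  set (F := fun z : C => (g z * Cexp (- Ci * (RtoC kappa * Lam z)))%C).
  assert (forall w, 0 < Im w -> Cmod (F w) = Cmod (g w) * exp (kappa * angle a b w)) as HF.
  { intros [x y] Hi. cbn [Im snd] in Hi. unfold F. rewrite Cmod_mult, Cmod_Cexp. do 2 f_equal.
    unfold Lam, Clog, angle. 
    set (u := (- Ci * ((x, y) - RtoC b))%C). set (v := (- Ci * ((x, y) - RtoC a))%C).
    replace (Im u / Re u) with ((b - x) / y) by (unfold u, Re, Im; cbn; field; lra).
    replace (Im v / Re v) with ((a - x) / y) by (unfold v, Re, Im; cbn; field; lra).
    unfold Re, Im; cbn. ring. }
  assert (forall w c, 0 < Im w -> 0 < Re (- Ci * (w - RtoC c))%C) as Hre.
  { intros [x y] c Hi. unfold Re, Im in *; cbn in *. lra. }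
  assert (forall w, 0 < Im w -> ex_Cderive F w) as HFd.
  { intros w Hw. apply ex_Cderive_mult; [apply Hg; lra|].
    apply (ex_Cderive_comp Cexp); [apply ex_Cderive_Cexp|].
    apply ex_Cderive_mult; [apply ex_Cderive_const|].
    apply ex_Cderive_mult; [apply ex_Cderive_const|].
    apply ex_Cderive_minus; (apply (ex_Cderive_comp Clog); [now apply ex_Cderive_Clog, Hre|]);
    (apply ex_Cderive_mult; [apply ex_Cderive_const|]);
    (apply ex_Cderive_minus_const). }
  set (B := exp (kappa * PI)).
  assert (0 < B) as HB0 by apply exp_pos.
  assert (forall w, 0 < Im w -> exp (kappa * angle a b w) <= B) as HB.
  { intros w Hw. apply exp_le_compat, Rmult_le_compat_l; [lra | apply angle_le_PI]. }
  assert (forall w d eps, Im w = 0 -> 0 < d -> 0 < eps ->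
    Re w <= a - 2 * d \/ b + 2 * d <= Re w ->
    locally w (fun v => 0 < Im v -> Cmod (F v) <= 1 + eps)) as Hout.
  { intros w d eps Hi Hd He Hw.
    assert (0 < ln (1 + eps)) as Hln by (rewrite <- ln_1; apply ln_increasing; lra).
    assert (0 < kappa * (b - a)) as Hkab by (apply Rmult_lt_0_compat; lra).
    assert (0 < d ^ 2) as Hd2 by (apply pow_lt; lra).
    set (eta := ln (1 + eps) * d ^ 2 / (kappa * (b - a))).
    assert (0 < eta) as Heta by (apply Rdiv_lt_0_compat; [apply Rmult_lt_0_compat; lra | lra]).
    apply locally_Cmod. exists (Rmin d eta). split; [now apply Rmin_pos|].
    intros v Hv Hvi. pose proof (Rmin_l d eta). pose proof (Rmin_r d eta).
    pose proof (re_le_Cmod (v - w)%C) as Tr. pose proof (im_le_Cmod (v - w)%C) as Ti.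
    replace (Re (v - w)%C) with (Re v - Re w) in Tr by reflexivity.
    replace (Im (v - w)%C) with (Im v - Im w) in Ti by reflexivity.
    apply Rabs_le_between in Tr. apply Rabs_le_between in Ti.
    rewrite HF by exact Hvi.
    assert (angle a b v <= (b - a) * Im v / d ^ 2) as HA by (apply angle_upper; lra).
    assert (kappa * angle a b v <= ln (1 + eps)) as HA2.
    { apply Rle_trans with (kappa * ((b - a) * eta / d ^ 2)).
      - apply Rmult_le_compat_l; [lra|]. eapply Rle_trans; [exact HA|].
        apply Rmult_le_compat_r; [left; now apply Rinv_0_lt_compat|].
        apply Rmult_le_compat_l; lra.
      - apply Req_le. unfold eta. field. lra. }
    apply exp_le_compat in HA2. rewrite exp_ln in HA2 by lra.
    replace (1 + eps) with (1 * (1 + eps)) by ring.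
    apply Rmult_le_compat; [apply Cmod_ge_0 | left; apply exp_pos | apply Hg; lra | exact HA2]. }
  assert (Cmod (F z) <= 1) as Hmain.
  { (* [F] has no singularity: the puncture is an arbitrary other point. *)
    apply (phragmen_lindelof F (z + Ci)%C); [| | | | exact Hz |].
    - replace (Im (z + Ci)%C) with (Im z + 1) by reflexivity. lra.
    - intros w Hw _. now apply HFd.
    - exists B. intros w Hw _. rewrite HF by exact Hw. rewrite <- (Rmult_1_l B).
      apply Rmult_le_compat; [apply Cmod_ge_0 | left; apply exp_pos | apply Hg; lra | now apply HB].
    - intros x eps He.
      enough (locally (RtoC x) (fun w => 0 < Im w -> Cmod (F w) <= 1 + eps)) as H
        by (eapply filter_imp; [|exact H]; auto).
      destruct (Rle_lt_dec a x) as [Hxa|Hxa]; [destruct (Rle_lt_dec x b) as [Hxb|Hxb]|].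
      + assert (0 < eps / B) as He' by (apply Rdiv_lt_0_compat; lra).
        eapply filter_imp; [|apply (locally_Cmod_lt g (RtoC x) (eps / B) He'); apply Hg; cbn; lra].
        intros v Hv Hv'. cbn beta in Hv. rewrite HF by exact Hv'.
        assert (Cmod (g (RtoC x)) <= / B) as Hgx.
        { unfold B. rewrite <- exp_Ropp. apply Hlow. lra. }
        specialize (HB v Hv').
        apply Rle_trans with ((/ B + eps / B) * B).
        * apply Rmult_le_compat; [apply Cmod_ge_0 | left; apply exp_pos | lra | exact HB].
        * apply Req_le. field. lra.
      + apply (Hout (RtoC x) ((x - b) / 2) eps); cbn; lra.
      + apply (Hout (RtoC x) ((a - x) / 2) eps); cbn; lra.
    - intros E. apply (f_equal Im) in E. replace (Im (z + Ci)%C) with (Im z + 1) in E by reflexivity. lra. }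
  rewrite HF in Hmain by exact Hz.
  rewrite exp_Ropp. pose proof (exp_pos (kappa * angle a b z)).
  apply Rmult_le_reg_r with (exp (kappa * angle a b z)); [lra|].
  rewrite Rinv_l by lra. exact Hmain.
Qed.

(** * Boundary behaviour of meromorphic inner functions *)

Lemma sum_n_le_gain (u v : nat -> R) (k n : nat) (c : R) :
  (forall j, u j <= v j) -> (k <= n)%nat -> u k + c <= v k ->
  sum_n u n + c <= sum_n v n.
Proof.
  intros Huv Hk Hc. rewrite !sum_n_Reals. induction n as [|n IH].
  - assert (k = O) as -> by lia. exact Hc.
  - cbn. destruct (Nat.eq_dec k (S n)) as [->|Hne].
    + pose proof (sum_Rle u v n (fun j _ => Huv j)). lra.
    + specialize (IH ltac:(lia)). specialize (Huv (S n)). lra.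
Qed.

Lemma sum_n_mono_index (u : nat -> R) (n m : nat) :
  (forall j, 0 <= u j) -> (n <= m)%nat -> sum_n u n <= sum_n u m.
Proof.
  intros Hu Hnm. induction Hnm as [|m _ IH]; [lra|].
  rewrite !sum_n_Reals in *. cbn. specialize (Hu (S m)). lra.
Qed.

(** Sweep [[a, b]] from left to right and measure what the covering intervals
    cover of [[a, t]]: a supremum argument shows that it is at least [t - a], so no
    cover has total length less than [b - a]. *)
Lemma interval_not_null (E : R -> Prop) (a b : R) :
  a < b -> (forall x, a <= x <= b -> E x) -> ~ null_set E.
Proof.
  intros Hab HE Hnull.
  assert (0 < (b - a) / 2) as He by lra.
  destruct (Hnull (mkposreal _ He)) as (l & r & Hlr & Hcov & Hsum).
  set (len := fun (t : R) (k : nat) => Rmax 0 (Rmin t (r k) - Rmax a (l k))).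
  assert (forall t k, 0 <= len t k) as Hlen0 by (intros; apply Rmax_l).
  assert (forall s t k, s <= t -> len s k <= len t k) as Hmono.
  { intros s t k Hst. apply Rle_max_compat_l, Rplus_le_compat_r, Rle_min_compat_r, Hst. }
  assert (forall t k, len t k <= r k - l k) as Hlenb.
  { intros t k. specialize (Hlr k). apply Rmax_lub; [lra|].
    pose proof (Rmin_r t (r k)). pose proof (Rmax_r a (l k)). lra. }
  destruct (completeness (fun t => a <= t <= b /\ exists n, t - a <= sum_n (len t) n)) as [T [Hub Hlub]].
  { exists b. intros t [Ht _]. lra. }
  { exists a. split; [lra|]. exists O. rewrite sum_O. specialize (Hlen0 a O). lra. }
  assert (a <= T) as HaT.
  { apply Hub. split; [lra|]. exists O. rewrite sum_O. specialize (Hlen0 a O). lra. }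
  assert (T <= b) as HTb by (apply Hlub; intros t [Ht _]; lra).
  destruct (Hcov T (HE T (conj HaT HTb))) as [k [Hk1 Hk2]].
  assert (exists t, (a <= t <= b /\ exists n, t - a <= sum_n (len t) n) /\ l k < t) as [t [[Ht [n Hn]] Hlt]].
  { apply NNPP. intros Hno. assert (T <= l k); [|lra]. apply Hlub. intros t Ht.
    apply Rnot_lt_le. intros Hlt. apply Hno. now exists t. }
  assert (t <= T) as HtT by (apply Hub; split; [exact Ht | now exists n]).
  set (t' := Rmin b ((T + r k) / 2)).
  assert (t' <= b) by apply Rmin_l.
  assert (t' <= (T + r k) / 2) by apply Rmin_r.
  assert (T <= t') by (apply Rmin_glb; lra).
  set (n' := Nat.max n k).
  assert (t' - a <= sum_n (len t') n') as Hn'.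
  { pose proof (sum_n_le_gain (len t) (len t') k n' (t' - t)) as G.
    pose proof (sum_n_mono_index (len t) n n' (Hlen0 t) ltac:(unfold n'; lia)).
    enough (sum_n (len t) n' + (t' - t) <= sum_n (len t') n') by lra.
    apply G; [intros; apply Hmono; lra | unfold n'; lia |].
    unfold len. rewrite (Rmin_left t), (Rmin_left t') by lra.
    assert (Rmax a (l k) <= t) by (apply Rmax_lub; lra).
    rewrite !(Rmax_right 0) by lra. lra. }
  assert (t' <= T) by (apply Hub; split; [lra | now exists n']).
  assert (t' = b) as Eb.
  { unfold t' in *. unfold Rmin in *. destruct (Rle_dec b ((T + r k) / 2)); lra. }
  rewrite Eb in Hn'.
  assert (sum_n (len b) n' <= sum_n (fun k => r k - l k) n').
  { rewrite !sum_n_Reals. apply sum_Rle. intros; apply Hlenb. }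
  assert (sum_n (fun k => r k - l k) n' <= (b - a) / 2) by exact (Hsum n'). lra.
Qed.

Lemma nontangential_limit_eq (f : C -> C) (x : R) (l : C) :
  ex_Cderive f (RtoC x) -> nontangential_limit f x l -> l = f (RtoC x).
Proof.
  intros Hf Hl.
  assert (Cmod (l - f (RtoC x))%C = 0) as H0.
  { apply cond_eq. intros eps He. rewrite Rminus_0_r, Rabs_right by (apply Rle_ge, Cmod_ge_0).
    destruct (proj1 (locally_Cmod _ _) (ex_Cderive_continuous f _ Hf (eps / 2) ltac:(lra))) as [d1 [Hd1 H1]].
    assert (locally l (fun w : C => Cmod (w - l)%C < eps / 2)) as HL.
    { apply locally_Cmod. exists (eps / 2). split; [lra | auto]. }
    destruct (proj1 (locally_Cmod _ _) (Hl 1 Rlt_0_1 _ HL)) as [d2 [Hd2 H2]].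
    set (y := Rmin d1 d2 / 2).
    assert (0 < y) as Hy by (unfold y; pose proof (Rmin_pos d1 d2 Hd1 Hd2); lra).
    assert (Cmod ((x, y) - RtoC x)%C = y) as Hm.
    { replace ((x, y) - RtoC x)%C with (Ci * RtoC y)%C by (apply injective_projections; cbn; ring).
      rewrite Cmod_mult, Cmod_Ci, Cmod_R, Rabs_right; lra. }
    pose proof (Rmin_l d1 d2). pose proof (Rmin_r d1 d2).
    specialize (H1 (x, y) ltac:(unfold y in *; lra)).
    specialize (H2 (x, y) ltac:(unfold y in *; lra)).
    assert (Cmod (f (x, y) - l)%C < eps / 2) as H3.
    { apply H2. split; [exact Hy|]. cbn. rewrite Rminus_diag, Rabs_R0. lra. }
    pose proof (Cmod_triangle (f (x, y) - f (RtoC x)) (- (f (x, y) - l)))%C as T.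
    rewrite Cmod_opp in T.
    replace (f (x, y) - f (RtoC x) + - (f (x, y) - l))%C with (l - f (RtoC x))%C in T by ring. lra. }
  apply Cmod_eq_0 in H0. replace l with ((l - f (RtoC x)) + f (RtoC x))%C by ring.
  rewrite H0. ring.
Qed.

(** A pole on the line is excluded by boundedness above it. *)
Lemma mif_derivable (f : C -> C) (z : C) :
  meromorphic_inner_function f -> 0 <= Im z -> ex_Cderive f z.
Proof.
  intros [[Han [[M HM] _]] Hmer] Hz.
  destruct (Hmer z) as [_ [H|Hpole]]; [exact H | exfalso].
  destruct (Hpole (fun y => M < y)) as [d Hd].
  { exists M. auto. }
  destruct z as [x y]. cbn in Hz.
  set (w := (x, y + d / 2) : C). pose proof (cond_pos d).
  assert (M < Cmod (f w)) as HMw.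
  { apply Hd.
    - split; [apply ball_center|].
      change (Rabs ((y + d / 2) - y) < d). rewrite Rabs_right; lra.
    - intros E. injection E. lra. }
  specialize (HM w). unfold upper_half_plane, w in HM. cbn in HM. unfold w in HMw. 
  specialize (HM ltac:(lra)). lra.
Qed.

(** Continuity upgrades almost everywhere to everywhere, since a null set contains
    no interval. *)
Lemma mif_unimodular (f : C -> C) (x : R) :
  meromorphic_inner_function f -> Cmod (f (RtoC x)) = 1.
Proof.
  intros Hf. pose proof Hf as [[_ [_ Hae]] _].
  assert (forall t, ex_Cderive f (RtoC t)) as Hd by (intros; apply mif_derivable; [exact Hf | cbn; lra]).
  apply NNPP. intros Hne.
  assert (0 < Rabs (Cmod (f (RtoC x)) - 1)) as Hp by (apply Rabs_pos_lt; lra).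
  destruct (proj1 (locally_Cmod _ _) (ex_Cderive_continuous f _ (Hd x) _ Hp)) as [d [Hd0 Hc]].
  revert Hae. apply (interval_not_null _ x (x + d / 2)); [lra|].
  intros t Ht [l [Hl Hl1]]. apply nontangential_limit_eq in Hl; [|apply Hd]. subst l.
  specialize (Hc (RtoC t)). rewrite <- RtoC_minus, Cmod_R, Rabs_right in Hc by lra.
  specialize (Hc ltac:(lra)).
  pose proof (Cmod_le_dist (f (RtoC x)) (f (RtoC t))) as T1.
  pose proof (Cmod_le_dist (f (RtoC t)) (f (RtoC x))) as T2.
  replace (f (RtoC x) - f (RtoC t))%C with (- (f (RtoC t) - f (RtoC x)))%C in T2 by ring.
  rewrite Cmod_opp in T2. rewrite Hl1 in *.
  revert Hc. unfold Rabs. destruct (Rcase_abs (Cmod (f (RtoC x)) - 1)); lra.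
Qed.

Lemma mif_le_1 (f : C -> C) (z : C) :
  meromorphic_inner_function f -> 0 <= Im z -> Cmod (f z) <= 1.
Proof.
  intros Hf [Hz|Hz].
  2: { replace z with (RtoC (Re z)) by (destruct z; apply injective_projections; cbn in *; congruence).
       rewrite mif_unimodular by exact Hf. lra. }
  apply (phragmen_lindelof f (z + Ci)%C).
  - replace (Im (z + Ci)%C) with (Im z + 1) by reflexivity. lra.
  - intros w Hw _. apply mif_derivable; [exact Hf | lra].
  - destruct Hf as [[_ [[M HM] _]] _]. exists M. intros w Hw _. now apply HM.
  - intros x eps He.
    eapply filter_imp; [|apply (locally_Cmod_lt f (RtoC x) eps He)]; [|apply mif_derivable; [exact Hf | cbn; lra]].
    intros w Hw _ _. cbn beta in Hw. rewrite mif_unimodular in Hw by exact Hf. lra.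
  - exact Hz.
  - intros E. apply (f_equal Im) in E. replace (Im (z + Ci)%C) with (Im z + 1) in E by reflexivity. lra.
Qed.

(** * The speed of the phase *)

Lemma is_derive_Re_real (f : C -> C) (x : R) (l : C) :
  is_Cderive f (RtoC x) l -> is_derive (fun t => Re (f (RtoC t))) x (Re l).
Proof.
  intros H. apply is_derive_Reals. intros eps He.
  destruct (proj1 (is_Cderive_iff _ _ _) H (eps / 2) ltac:(lra)) as [d [Hd Hf]].
  exists (mkposreal d Hd). intros h Hh Hhd. cbn in Hhd.
  specialize (Hf (RtoC (x + h))). rewrite <- RtoC_minus in Hf.
  replace (x + h - x) with h in Hf by ring. rewrite !Cmod_R in Hf. specialize (Hf Hhd).
  pose proof (re_le_Cmod (f (RtoC (x + h)) - f (RtoC x) - l * RtoC h)%C) as T.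
  replace (Re (f (RtoC (x + h)) - f (RtoC x) - l * RtoC h)%C)
    with (h * ((Re (f (RtoC (x + h))) - Re (f (RtoC x))) / h - Re l)) in T.
  2: { unfold Re; cbn. field. exact Hh. }
  rewrite Rabs_mult in T. pose proof (Rabs_pos_lt h Hh).
  apply Rmult_lt_reg_l with (Rabs h); [assumption|]. nra.
Qed.

Lemma is_derive_Im_real (f : C -> C) (x : R) (l : C) :
  is_Cderive f (RtoC x) l -> is_derive (fun t => Im (f (RtoC t))) x (Im l).
Proof.
  intros H. apply is_derive_Reals. intros eps He.
  destruct (proj1 (is_Cderive_iff _ _ _) H (eps / 2) ltac:(lra)) as [d [Hd Hf]].
  exists (mkposreal d Hd). intros h Hh Hhd. cbn in Hhd.
  specialize (Hf (RtoC (x + h))). rewrite <- RtoC_minus in Hf.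
  replace (x + h - x) with h in Hf by ring. rewrite !Cmod_R in Hf. specialize (Hf Hhd).
  pose proof (im_le_Cmod (f (RtoC (x + h)) - f (RtoC x) - l * RtoC h)%C) as T.
  replace (Im (f (RtoC (x + h)) - f (RtoC x) - l * RtoC h)%C)
    with (h * ((Im (f (RtoC (x + h))) - Im (f (RtoC x))) / h - Im l)) in T.
  2: { unfold Im; cbn. field. exact Hh. }
  rewrite Rabs_mult in T. pose proof (Rabs_pos_lt h Hh).
  apply Rmult_lt_reg_l with (Rabs h); [assumption|]. nra.
Qed.

Lemma is_derive_increase (g g' : R -> R) (a b m : R) :
  a < b -> (forall x, a <= x <= b -> is_derive g x (g' x)) -> (forall x, a <= x <= b -> m <= g' x) ->
  m * (b - a) <= g b - g a.
Proof.
  intros Hab Hg Hm.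
  destruct (MVT_cor2 g g' a b Hab) as [c [-> Hc]].
  { intros; apply is_derive_Reals; auto. }
  apply Rmult_le_compat_r; [lra|]. apply Hm; lra.
Qed.

(** The derivative [phi'] of the phase of a function [f = exp (i phi)] that is
    unimodular on the line. *)
Definition speed (f : C -> C) (x : R) : R := Im (Cconj (f (RtoC x)) * C_derive f (RtoC x))%C.

Lemma unit_sqr (z : C) : Cmod z = 1 -> Re z * Re z + Im z * Im z = 1.
Proof.
  intros H. pose proof (Cmod2_alt z) as E. rewrite H in E. lra.
Qed.

Section unimodular.
Variable f : C -> C.
Hypothesis f_deriv : forall x : R, ex_Cderive f (RtoC x).
Hypothesis f_unit : forall x : R, Cmod (f (RtoC x)) = 1.

(** Differentiating [|f|^2 = 1] shows that [f'] is an imaginary multiple of [f]. *)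
Lemma is_Cderive_speed (x : R) :
  is_Cderive f (RtoC x) (Ci * RtoC (speed f x) * f (RtoC x))%C.
Proof.
  pose proof (C_derive_correct f (RtoC x) (RtoC 0) (f_deriv x)) as H.
  pose proof (is_derive_Re_real _ _ _ H) as HR. pose proof (is_derive_Im_real _ _ _ H) as HI.
  pose proof (unit_sqr _ (f_unit x)) as Hu.
  set (l := C_derive f (RtoC x)) in *.
  replace (Ci * RtoC (speed f x) * f (RtoC x))%C with l; [exact H|].
  assert (Re (f (RtoC x)) * Re l + Im (f (RtoC x)) * Im l = 0) as H0.
  { assert (is_derive (fun _ : R => 1) x
      (2 * (Re (f (RtoC x)) * Re l + Im (f (RtoC x)) * Im l))) as HD.
    { apply (is_derive_ext (fun t => Re (f (RtoC t)) * Re (f (RtoC t)) + Im (f (RtoC t)) * Im (f (RtoC t)))).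
      { intros t. apply unit_sqr, f_unit. }
      evar_last.
      - apply (is_derive_plus (V := R_NormedModule));
        apply Derive.is_derive_mult; eassumption.
      - cbn. unfold plus; cbn. ring. }
    pose proof (is_derive_unique _ _ _ HD) as U.
    rewrite Derive_const in U. lra. }
  unfold speed. fold l. revert H0 Hu. generalize (f (RtoC x)). intros [a b]. destruct l as [c d].
  cbn. unfold Re, Im; cbn. intros H0 Hu.
  apply injective_projections; cbn.
  - transitivity (c * (a * a + b * b) - a * (a * c + b * d)); [rewrite H0, Hu | ]; ring.
  - transitivity (d * (a * a + b * b) - b * (a * c + b * d)); [rewrite H0, Hu | ]; ring.
Qed.

Lemma Cmod_derive (x : R) : Cmod (C_derive f (RtoC x)) = Rabs (speed f x).
Proof.
  rewrite (is_C_derive_unique _ _ _ (is_Cderive_speed x)).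
  rewrite !Cmod_mult, Cmod_Ci, Cmod_R, f_unit. ring.
Qed.

(** The Cauchy-Riemann equations: the speed is also the normal derivative of
    [- ln |f|] at the line. *)
Lemma normal_derivative (x eps : R) : 0 < eps ->
  exists d, 0 < d /\ forall y, 0 < y < d ->
    Rabs (Cmod (f (x, y)) - (1 - speed f x * y)) <= eps * y.
Proof.
  intros He. set (q := speed f x).
  destruct (proj1 (is_Cderive_iff _ _ _) (is_Cderive_speed x) eps He) as [d [Hd Hf]].
  exists (Rmin d (/ (Rabs q + 1))). pose proof (Rabs_pos q) as Hq.
  assert (0 < / (Rabs q + 1)) as Hq1 by (apply Rinv_0_lt_compat; lra).
  split; [now apply Rmin_pos|]. intros y Hy.
  pose proof (Rmin_l d (/ (Rabs q + 1))). pose proof (Rmin_r d (/ (Rabs q + 1))).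
  specialize (Hf (x, y)).
  replace ((x, y) - RtoC x)%C with (Ci * RtoC y)%C in Hf by (apply injective_projections; cbn; ring).
  rewrite (Cmod_mult Ci), Cmod_Ci, Cmod_R, (Rabs_right y), Rmult_1_l in Hf by lra.
  specialize (Hf ltac:(lra)). fold q in Hf.
  assert (Cmod (f (RtoC x) * RtoC (1 - q * y))%C = 1 - q * y) as E.
  { rewrite Cmod_mult, f_unit, Cmod_R, Rabs_right; [ring|].
    assert (Rabs q * y <= 1).
    { apply Rle_trans with ((Rabs q + 1) * / (Rabs q + 1)); [apply Rmult_le_compat; lra|].
      rewrite Rinv_r; lra. }
    pose proof (Rle_abs q). nra. }
  replace (f (x, y) - f (RtoC x) - Ci * RtoC q * f (RtoC x) * (Ci * RtoC y))%C
    with (f (x, y) - f (RtoC x) * RtoC (1 - q * y))%C in Hf.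
  2: { rewrite RtoC_minus, RtoC_mult. replace (Ci * RtoC q * f (RtoC x) * (Ci * RtoC y))%C
       with ((Ci * Ci) * (RtoC q * RtoC y * f (RtoC x)))%C by ring.
       replace (Ci * Ci)%C with (- RtoC 1)%C by (apply injective_projections; cbn; ring). ring. }
  pose proof (Cmod_le_dist (f (RtoC x) * RtoC (1 - q * y))%C (f (x, y))) as T1.
  pose proof (Cmod_le_dist (f (x, y)) (f (RtoC x) * RtoC (1 - q * y))%C) as T2.
  rewrite E in *.
  replace (f (RtoC x) * RtoC (1 - q * y) - f (x, y))%C
    with (- (f (x, y) - f (RtoC x) * RtoC (1 - q * y)))%C in T2 by ring.
  rewrite Cmod_opp in T2. apply Rabs_le. lra.
Qed.

Lemma speed_le (x K d : R) : 0 < d ->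
  (forall y, 0 < y < d -> 1 - K * y <= Cmod (f (x, y))) -> speed f x <= K.
Proof.
  intros Hd H. apply le_epsilon. intros eps He.
  destruct (normal_derivative x eps He) as [e [He' Hn]].
  set (y := Rmin d e / 2). pose proof (Rmin_pos d e Hd He').
  pose proof (Rmin_l d e). pose proof (Rmin_r d e).
  specialize (H y ltac:(unfold y; lra)). specialize (Hn y ltac:(unfold y; lra)).
  apply Rabs_le_between in Hn. apply Rmult_le_reg_r with y; [unfold y; lra|]. lra.
Qed.

Lemma speed_ge (x K d : R) : 0 < d ->
  (forall y, 0 < y < d -> Cmod (f (x, y)) <= 1 - K * y) -> K <= speed f x.
Proof.
  intros Hd H. apply le_epsilon. intros eps He.
  destruct (normal_derivative x eps He) as [e [He' Hn]].
  set (y := Rmin d e / 2). pose proof (Rmin_pos d e Hd He').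
  pose proof (Rmin_l d e). pose proof (Rmin_r d e).
  specialize (H y ltac:(unfold y; lra)). specialize (Hn y ltac:(unfold y; lra)).
  apply Rabs_le_between in Hn. apply Rmult_le_reg_r with y; [unfold y; lra|]. lra.
Qed.

Let al (t : R) : R := Re (f (RtoC t)).
Let be (t : R) : R := Im (f (RtoC t)).

Lemma is_derive_al (x : R) : is_derive al x (- (speed f x * be x)).
Proof.
  evar_last; [apply is_derive_Re_real, is_Cderive_speed|].
  unfold be. generalize (f (RtoC x)). intros [a b]. unfold Re, Im; cbn. ring.
Qed.

Lemma is_derive_be (x : R) : is_derive be x (speed f x * al x).
Proof.
  evar_last; [apply is_derive_Im_real, is_Cderive_speed|].
  unfold al. generalize (f (RtoC x)). intros [a b]. unfold Re, Im; cbn. ring.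
Qed.

(** The phase turns once between consecutive points of the spectrum, so the speed
    is large somewhere if they are close. If it were less than [1 / (b - a)]
    throughout, [f] would stay in the right half-plane, where [Im f] increases
    with the phase; vanishing at both ends, it would be zero, and [f] would be
    constant. *)
Lemma short_interval (a b : R) :
  (forall x, 0 <= speed f x) -> a < b ->
  f (RtoC a) = RtoC 1 -> f (RtoC b) = RtoC 1 -> (forall x, a < x < b -> f (RtoC x) <> RtoC 1) ->
  exists xi, a <= xi <= b /\ / (b - a) <= speed f xi.
Proof.
  intros Hq Hab Ha Hb Hne. apply NNPP. intros Hno.
  assert (forall x, a <= x <= b -> speed f x < / (b - a)) as Hs.
  { intros x Hx. apply Rnot_le_lt. intros HC. apply Hno. now exists x. }
  assert (forall x, al x * al x + be x * be x = 1) as Hu by (intros; apply unit_sqr, f_unit).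
  assert (al a = 1 /\ be a = 0 /\ be b = 0) as (Ea & Eb1 & Eb2)
    by (unfold al, be; rewrite Ha, Hb; auto).
  assert (forall x, a <= x <= b -> 1 - (x - a) * / (b - a) <= al x) as Hal.
  { intros x [[Hx| <-] Hxb]; [|lra].
    pose proof (is_derive_increase al _ a x (- / (b - a)) Hx (fun t _ => is_derive_al t)) as H.
    rewrite <- Ea. enough (- / (b - a) * (x - a) <= al x - al a) by lra.
    apply H. intros t Ht. specialize (Hs t ltac:(lra)). specialize (Hq t). specialize (Hu t).
    apply Ropp_le_contravar. 
    assert (be t <= 1) by nra.
    apply Rle_trans with (speed f t * 1); [apply Rmult_le_compat_l|]; lra. }
  assert (forall x, a <= x <= b -> 0 <= al x) as Hal0.
  { intros x Hx. specialize (Hal x Hx).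
    assert ((x - a) * / (b - a) <= 1); [|lra].
    rewrite <- (Rinv_r (b - a)) by lra. apply Rmult_le_compat_r; [|lra].
    left; apply Rinv_0_lt_compat; lra. }
  assert (forall s t, a <= s -> s < t -> t <= b -> be s <= be t) as Hbe.
  { intros s t H1 H2 H3.
    pose proof (is_derive_increase be _ s t 0 H2 (fun t _ => is_derive_be t)) as H.
    enough (0 * (t - s) <= be t - be s) by lra. apply H. intros x Hx.
    apply Rmult_le_pos; [apply Hq | apply Hal0; lra]. }
  set (m := (a + b) / 2).
  assert (a < m < b) as Hm by (unfold m; lra).
  assert (be m = 0) as Em.
  { apply Rle_antisym; [rewrite <- Eb2 | rewrite <- Eb1]; apply Hbe; lra. }
  apply (Hne m Hm).
  assert (al m = 1) as Em1.
  { specialize (Hal0 m ltac:(lra)). specialize (Hu m). rewrite Em in Hu. nra. }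
  unfold al, be in *. destruct (f (RtoC m)) as [u v]. cbn in *. unfold RtoC. congruence.
Qed.

(** The phase gains at most [2 PI] where [f] avoids the value [1], because there
    [2 * atan (- Im f / (1 - Re f))] is a bounded branch of it. The speed of the
    form [c / (T - x)] integrates to a logarithm. *)
Lemma gap_log (x1 x2 T c : R) :
  x1 < x2 -> x2 < T -> (forall x, x1 <= x <= x2 -> f (RtoC x) <> RtoC 1) ->
  (forall x, x1 <= x <= x2 -> c / (T - x) <= speed f x) ->
  c * (ln (T - x1) - ln (T - x2)) <= 2 * PI.
Proof.
  intros H12 H2 Hne Hs.
  assert (forall x, al x * al x + be x * be x = 1) as Hu by (intros; apply unit_sqr, f_unit).
  assert (forall x, x1 <= x <= x2 -> 0 < 1 - al x) as Hal.
  { intros x Hx. specialize (Hu x). specialize (Hne x Hx).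
    assert (al x <= 1) as [Hl|He] by nra; [lra|]. exfalso. apply Hne.
    rewrite He in Hu. assert (be x = 0) as Hb by nra.
    unfold al, be in *. destruct (f (RtoC x)) as [u v]. cbn in *. unfold RtoC. congruence. }
  set (G := fun x => 2 * atan (- be x / (1 - al x)) + c * ln (T - x)).
  assert (forall x, x1 <= x <= x2 -> is_derive G x (speed f x - c / (T - x))) as HG.
  { intros x Hx. specialize (Hal x Hx). specialize (Hu x).
    pose proof (is_derive_al x) as Da. pose proof (is_derive_be x) as Db.
    unfold G. auto_derive.
    - repeat split; try lra; [now exists (speed f x * al x) | now exists (- (speed f x * be x))].
    - replace (Derive (fun x0 => al x0) x) with (- (speed f x * be x))
        by (symmetry; now apply is_derive_unique).
      replace (Derive (fun x0 => be x0) x) with (speed f x * al x)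
        by (symmetry; now apply is_derive_unique).
      assert (be x * be x = 1 - al x * al x) as Eb by lra.
      replace (1 + (- be x * / (1 + - al x)) ^ 2) with (2 / (1 - al x)).
      2: { field_simplify; [|lra..]. replace (be x ^ 2) with (1 - al x ^ 2) by lra.
           field. split; [nra | lra]. }
      field_simplify; [|lra..]. replace (be x ^ 2) with (1 - al x ^ 2) by lra.
      field. repeat split; nra. }
  pose proof (is_derive_increase G _ x1 x2 0 H12 HG) as H.
  assert (0 * (x2 - x1) <= G x2 - G x1) as HGle.
  { apply H. intros x Hx. specialize (Hs x Hx). lra. }
  unfold G in HGle.
  pose proof (atan_bound (- be x1 / (1 - al x1))). pose proof (atan_bound (- be x2 / (1 - al x2))).
  lra.
Qed.
End unimodular.

Lemma exp_neg_le (t : R) : 0 <= t <= 1 -> exp (- t) <= 1 - t / 2.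
Proof.
  intros Ht. rewrite exp_Ropp. pose proof (exp_ineq1_le t).
  apply Rle_trans with (/ (1 + t)); [apply Rinv_le_contravar; lra|].
  apply Rmult_le_reg_r with (1 + t); [lra|]. rewrite Rinv_l by lra. nra.
Qed.

(** * Functions without zeros in a strip *)

Section zero_free_strip.
Variables (f : C -> C) (delta : R).
Hypothesis f_deriv : forall z, 0 <= Im z -> ex_Cderive f z.
Hypothesis f_le_1 : forall z, 0 <= Im z -> Cmod (f z) <= 1.
Hypothesis f_unit : forall x : R, Cmod (f (RtoC x)) = 1.
Hypothesis f_neq_0 : forall z, 0 < Im z < delta -> f z <> RtoC 0.

Let u (x y : R) : R := - ln (Cmod (f (x, y))).

Lemma strip_neq_0 (z : C) : 0 <= Im z < delta -> f z <> RtoC 0.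
Proof.
  intros [[Hz|Hz] Hd]; [now apply f_neq_0|].
  replace z with (RtoC (Re z)) by (destruct z; apply injective_projections; cbn in *; congruence).
  apply Cmod_gt_0. rewrite f_unit. lra.
Qed.

Lemma ex_Cderive_real (x : R) : ex_Cderive f (RtoC x).
Proof. apply f_deriv; cbn; lra. Qed.

Lemma Cmod_exp_u (x y : R) : 0 <= y < delta -> Cmod (f (x, y)) = exp (- u x y).
Proof.
  intros Hy. unfold u. rewrite Ropp_involutive, exp_ln; [reflexivity|].
  apply Cmod_gt_0, strip_neq_0. exact Hy.
Qed.

Lemma strip_harnack (x h : R) (z : C) (rho : R) :
  0 < h -> 2 * h < delta -> rho < 1 -> Cmod (z - (x, h))%C <= rho * h ->
  (1 - rho) * u x h <= (1 + rho) * u (Re z) (Im z) /\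
  (1 - rho) * u (Re z) (Im z) <= (1 + rho) * u x h.
Proof.
  intros Hh Hd Hrho Hz.
  replace (u (Re z) (Im z)) with (- ln (Cmod (f z))) by (unfold u; now destruct z).
  apply (harnack f (x, h) h Hh); [|exact Hz|exact Hrho].
  intros w Hw.
  pose proof (im_le_Cmod (w - (x, h))%C) as T.
  replace (Im (w - (x, h))%C) with (Im w - h) in T by (destruct w; reflexivity).
  apply Rabs_le_between in T.
  split; [apply f_deriv; lra | split; [apply strip_neq_0; lra | apply f_le_1; lra]].
Qed.

(** The disc of centre [x + i h] and radius [h] touches the line at [x]; on its
    vertical radius Harnack's constants degenerate linearly. *)
Lemma harnack_vertical (x y h : R) : 0 < y <= h -> 2 * h < delta ->
  y * u x h <= (2 * h - y) * u x y /\ y * u x y <= (2 * h - y) * u x h.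
Proof.
  intros Hy Hd.
  assert ((h - y) / h < 1) as Hr by (apply Rlt_div_l; lra).
  destruct (strip_harnack x h (x, y) ((h - y) / h) ltac:(lra) Hd Hr) as [A B].
  { rewrite Cmod_vertical, Rabs_left1 by lra. apply Req_le. field; lra. }
  cbn [Re Im fst snd] in A, B.
  replace (1 - (h - y) / h) with (y / h) in A, B by (field; lra).
  replace (1 + (h - y) / h) with ((2 * h - y) / h) in A, B by (field; lra).
  split.
  - apply Rmult_le_reg_r with (/ h); [apply Rinv_0_lt_compat; lra|].
    unfold Rdiv in A. lra.
  - apply Rmult_le_reg_r with (/ h); [apply Rinv_0_lt_compat; lra|].
    unfold Rdiv in B. lra.
Qed.

(** Harnack's inequality along [k] horizontal steps of length [h / 2], each of which
    costs a factor [(1 + 1/2) / (1 - 1/2) = 3]. *)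
Lemma harnack_chain (h : R) (k : nat) : 0 < h -> 2 * h < delta ->
  forall x x', Rabs (x - x') <= INR k * (h / 2) -> u x h <= 3 ^ k * u x' h.
Proof.
  intros Hh Hd. 
  assert (forall x x', Rabs (x - x') <= h / 2 -> u x h <= 3 * u x' h) as Hone.
  { intros x x' Hx. destruct (strip_harnack x h (x', h) (/ 2) Hh Hd ltac:(lra)) as [A B].
    { rewrite Cmod_horizontal, Rabs_minus_sym. lra. }
    cbn [Re Im fst snd] in A. lra. }
  induction k as [|k IH]; intros x x' Hx.
  - cbn [INR] in Hx. rewrite Rmult_0_l in Hx.
    assert (x = x') as ->; [|cbn; lra].
    pose proof (Rabs_pos (x - x')). apply Rminus_diag_uniq. 
    destruct (Req_dec (x - x') 0) as [E|E]; [exact E|]. apply Rabs_pos_lt in E. lra.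
  - rewrite S_INR in Hx. apply Rabs_le_between in Hx.
    set (m := x' + (x - x') * (INR k / (INR k + 1))).
    pose proof (pos_INR k).
    assert (Rabs (x - m) <= h / 2) as H1.
    { replace (x - m) with ((x - x') / (INR k + 1)) by (unfold m; field; lra).
      unfold Rdiv. rewrite Rabs_mult, (Rabs_right (/ (INR k + 1))) by (apply Rle_ge, Rlt_le, Rinv_0_lt_compat; lra).
      apply Rle_div_l; [lra|]. apply Rabs_le. lra. }
    assert (Rabs (m - x') <= INR k * (h / 2)) as H2.
    { replace (m - x') with ((x - x') * INR k / (INR k + 1)) by (unfold m; field; lra).
      unfold Rdiv. rewrite Rabs_mult, (Rabs_right (/ (INR k + 1))) by (apply Rle_ge, Rlt_le, Rinv_0_lt_compat; lra).
      apply Rle_div_l; [lra|]. rewrite Rabs_mult, (Rabs_right (INR k)) by lra.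
      assert (Rabs (x - x') <= (INR k + 1) * (h / 2)) by (apply Rabs_le; lra).
      replace (INR k * (h * / 2) * (INR k + 1)) with ((INR k + 1) * (h / 2) * INR k) by (unfold Rdiv; ring).
      apply Rmult_le_compat_r; lra. }
    specialize (Hone x m H1). specialize (IH m x' H2). cbn. lra.
Qed.

Lemma u_nonneg (x y : R) : 0 <= y < delta -> 0 <= u x y.
Proof.
  intros Hy. unfold u.
  assert (0 < Cmod (f (x, y))) as H1 by (apply Cmod_gt_0, strip_neq_0; exact Hy).
  assert (Cmod (f (x, y)) <= 1) as H2 by (apply f_le_1; cbn; lra).
  pose proof (ln_le _ _ H1 H2). rewrite ln_1 in *. lra.
Qed.

(** On the half-disc of radius [h / 2] at [xi], going up to height [h] and then
    over to [xi + i h] gives [u <= 6 h u(xi, h) / y]; [halfdisc_bound] turns this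
    into a bound for the normal derivative. *)
Lemma speed_le_interior (xi h : R) : 0 < h -> 2 * h < delta ->
  speed f xi <= 48 * u xi h / h.
Proof.
  intros Hh Hd. pose proof (u_nonneg xi h ltac:(lra)) as Hu.
  set (K := 6 * h * u xi h).
  assert (0 <= K) as HK by (unfold K; repeat apply Rmult_le_pos; lra).
  apply (speed_le f ex_Cderive_real f_unit xi _ (h / 2)); [lra|].
  intros y Hy. apply Rle_trans with (exp (- (48 * u xi h / h * y))).
  { eapply Rle_trans; [|apply exp_ineq1_le]. lra. }
  replace (48 * u xi h / h) with (2 * K / (h / 2) ^ 2) by (unfold K; field; lra).
  apply (halfdisc_bound f xi (h / 2) K); [lra | exact HK | | | | exact Hy].
  - intros z Hz Hi. split; [now apply f_deriv | apply strip_neq_0].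
    pose proof (im_le_Cmod (z - RtoC xi)%C) as T. pose proof (Rle_abs (Im (z - RtoC xi)%C)).
    replace (Im (z - RtoC xi)%C) with (Im z - 0) in * by reflexivity. lra.
  - intros x _. apply f_unit.
  - intros [a b] Hz Hi. cbn [Im snd] in *.
    pose proof (im_le_Cmod ((a, b) - RtoC xi)%C) as Ti. pose proof (Rle_abs (Im ((a, b) - RtoC xi)%C)).
    pose proof (re_le_Cmod ((a, b) - RtoC xi)%C) as Tr.
    replace (Im ((a, b) - RtoC xi)%C) with (b - 0) in * by reflexivity.
    replace (Re ((a, b) - RtoC xi)%C) with (a - xi) in * by reflexivity.
    rewrite Cmod_exp_u by lra. apply exp_le_compat, Ropp_le_contravar.
    apply Rle_div_r; [lra|].
    destruct (harnack_vertical a b h ltac:(lra) Hd) as [_ HV].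
    pose proof (harnack_chain h 1 Hh Hd a xi ltac:(cbn; lra)) as HC. cbn in HC.
    pose proof (u_nonneg a h ltac:(lra)).
    apply Rle_trans with (2 * h * u a h); [|unfold K; nra]. nra.
Qed.

(** The Hopf lemma, from [harnack_vertical]: [u] grows at least linearly above the
    line. *)
Lemma speed_ge_interior (x h : R) : 0 < h -> 2 * h < delta ->
  u x h / (4 * h) <= speed f x.
Proof.
  intros Hh Hd. pose proof (u_nonneg x h ltac:(lra)) as Hu.
  set (kap := u x h / (2 * h)).
  assert (0 <= kap) as Hkap by (apply Rdiv_le_0_compat; lra).
  assert (0 < / (kap + 1)) as Hk1 by (apply Rinv_0_lt_compat; lra).
  apply (speed_ge f ex_Cderive_real f_unit x _ (Rmin h (/ (kap + 1)))); [now apply Rmin_pos|].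
  intros y Hy. pose proof (Rmin_l h (/ (kap + 1))). pose proof (Rmin_r h (/ (kap + 1))).
  rewrite Cmod_exp_u by lra.
  destruct (harnack_vertical x y h ltac:(lra) Hd) as [HV _].
  pose proof (u_nonneg x y ltac:(lra)).
  assert (kap * y <= u x y) as HL.
  { unfold kap. replace (u x h / (2 * h) * y) with (y * u x h / (2 * h)) by (field; lra).
    apply Rle_div_l; [lra|]. nra. }
  assert (0 <= kap * y <= 1) as H01.
  { split; [apply Rmult_le_pos; lra|]. apply Rle_trans with ((kap + 1) * / (kap + 1)).
    - apply Rmult_le_compat; lra.
    - rewrite Rinv_r; lra. }
  apply Rle_trans with (exp (- (kap * y))); [apply exp_le_compat; lra|].
  replace (u x h / (4 * h)) with (kap / 2) by (unfold kap; field; lra).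
  pose proof (exp_neg_le _ H01). lra.
Qed.

Lemma speed_nonneg (x : R) : 0 < delta -> 0 <= speed f x.
Proof.
  intros Hd. apply (speed_ge f ex_Cderive_real f_unit x 0 delta Hd).
  intros y Hy. rewrite Rmult_0_l, Rminus_0_r. apply f_le_1. cbn; lra.
Qed.

(** Only the part [[a, a + r]] of the block is used; from the point [a - r] at
    height [h] above the line of comparison it is seen under an angle of order
    [h / r]. *)
Lemma speed_beside_block (a b c h r : R) :
  0 < h -> 4 * h < delta -> 0 < c -> (forall x, a <= x <= b -> c <= u x h) ->
  h <= r <= b - a -> c / (40 * PI) / r <= speed f (a - r).
Proof.
  intros Hh Hd Hc Hu Hr. pose proof PI_RGT_0 as Hpi.
  assert (0 < c / PI) as Hkap by (apply Rdiv_lt_0_compat; lra).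
  pose proof (angle_bound (fun z => f (z + RtoC h * Ci)%C) a (a + r) (c / PI) ltac:(lra) Hkap) as HA.
  assert (forall z, Im (z + RtoC h * Ci)%C = Im z + h) as HIm by (intros [p q]; cbn; ring).
  set (x0 := a - r). set (h2 := 2 * h).
  assert (Cmod (f (x0, h2)) <= exp (- (c / PI * angle a (a + r) (x0, h)))) as HB.
  { replace ((x0, h2) : C) with ((x0, h) + RtoC h * Ci)%C by (apply injective_projections; cbn; unfold h2; ring).
    apply HA; [| | cbn; lra].
    - intros z Hz. split; [|apply f_le_1; rewrite HIm; lra].
      apply (ex_Cderive_comp f); [apply f_deriv; rewrite HIm; lra|].
      apply ex_Cderive_plus_const.
    - intros x Hx. replace (RtoC x + RtoC h * Ci)%C with ((x, h) : C) by (apply injective_projections; cbn; ring).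
      rewrite Cmod_exp_u by lra. apply exp_le_compat, Ropp_le_contravar.
      replace (c / PI * PI) with c by (field; lra). apply Hu; lra. }
  rewrite Cmod_exp_u in HB by (unfold h2; lra).
  assert (c / PI * angle a (a + r) (x0, h) <= u x0 h2) as HC.
  { apply Rnot_lt_le. intros HL. apply Ropp_lt_contravar, exp_increasing in HL. lra. }
  pose proof (angle_lower a (a + r) (x0, h) ltac:(cbn; lra) ltac:(cbn; unfold x0; lra) ltac:(lra)) as HD.
  cbn [Re Im fst snd] in HD.
  replace (a + r - x0) with (2 * r) in HD by (unfold x0; ring). replace (a + r - a) with r in HD by ring.
  assert (h / (5 * r) <= angle a (a + r) (x0, h)) as HE.
  { eapply Rle_trans; [|exact HD].
    assert (h ^ 2 <= r ^ 2) by (apply pow_incr; lra).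
    assert (0 < h ^ 2) by (apply pow_lt; lra).
    replace (h / (5 * r)) with (r * h / (5 * r ^ 2)) by (field; lra).
    apply Rmult_le_compat_l; [apply Rmult_le_pos; lra|]. apply Rinv_le_contravar; nra. }
  eapply Rle_trans; [|apply (speed_ge_interior x0 h2); unfold h2; lra].
  apply Rle_trans with (c / PI * (h / (5 * r)) / (4 * h2)).
  { apply Req_le. unfold h2. field. repeat split; lra. }
  apply Rmult_le_compat_r; [left; apply Rinv_0_lt_compat; unfold h2; lra|].
  eapply Rle_trans; [|exact HC]. apply Rmult_le_compat_l; [lra | exact HE].
Qed.
End zero_free_strip.

(** * Blocks of the spectrum *)

Lemma chain_lt (t : nat -> R) (N : nat) :
  (forall n : nat, (1 <= n < N)%nat -> t n < t (S n)) ->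
  forall i j, (1 <= i)%nat -> (i < j <= N)%nat -> t i < t j.
Proof.
  intros Ht i j Hi [Hij HjN]. induction Hij as [|j Hij IH].
  - apply Ht; lia.
  - apply Rlt_trans with (t j); [apply IH; lia | apply Ht; lia].
Qed.

Lemma chain_locate (t : nat -> R) (a b : nat) (x : R) :
  (a < b)%nat -> t a <= x <= t b ->
  exists n, (a <= n < b)%nat /\ t n <= x <= t (S n).
Proof.
  intros Hab Hx. induction Hab as [|b Hab IH].
  - exists a. split; [lia | exact Hx].
  - destruct (Rle_lt_dec x (t b)) as [Hxb|Hxb].
    + destruct IH as [n [Hn Hnx]]; [lra|]. exists n. split; [lia | exact Hnx].
    + exists b. split; [lia | lra].
Qed.

Lemma chain_growth (t : nat -> R) (a k : nat) (d : R) :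
  (forall n, (a <= n < a + k)%nat -> t n + d <= t (S n)) -> t a + INR k * d <= t (a + k)%nat.
Proof.
  induction k as [|k IH]; intros H.
  - rewrite Nat.add_0_r. cbn. lra.
  - rewrite Nat.add_succ_r, S_INR. specialize (H (a + k)%nat ltac:(lia)) as H'.
    specialize (IH ltac:(intros; apply H; lia)). lra.
Qed.

(** If the strip of width [delta] were free of zeros, the speed at distance [r] to
    the left of a block would be at least [c / r] with [c] depending only on
    [delta] and [D], and the gap would carry a phase of [c ln (r / h)], too large
    for a long enough block. *)
Lemma zeros_near_line (s : nat -> R) (D : R) (Theta : C -> C) (delta : R)
  (s_separated : separated s)
  (D_pos : 0 < D)
  (s_blocks : forall N : nat, (2 <= N)%nat ->
    exists t : nat -> R,
      (forall n : nat, (1 <= n < N)%nat -> t n < t (S n)) /\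
      (forall x : R,
         (t 1%nat <= x <= t N /\ exists m : nat, s m = x) <->
         (exists n : nat, (1 <= n <= N)%nat /\ t n = x)) /\
      t 2%nat - t 1%nat > INR N * D /\
      (forall n : nat, (2 <= n <= N - 1)%nat -> t (S n) - t n < D))
  (Theta_mif : meromorphic_inner_function Theta)
  (Theta_spectrum : forall x : R, spectrum Theta x <-> exists n : nat, s n = x) :
  0 < delta -> exists x y : R, Theta (x, y) = RtoC 0 /\ 0 < y < delta.
Proof.
  intros Hdelta. apply NNPP. intros Hno.
  assert (forall z, 0 < Im z < delta -> Theta z <> RtoC 0) as Hnz.
  { intros [x y] Hy HC. apply Hno. now exists x, y. }
  pose proof (fun z => mif_derivable Theta z Theta_mif) as Hd.
  pose proof (fun z => mif_le_1 Theta z Theta_mif) as H1.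
  pose proof (fun x => mif_unimodular Theta x Theta_mif) as Hunit.
  pose proof (ex_Cderive_real Theta Hd) as Hdr.
  pose proof PI_RGT_0 as Hpi.
  destruct s_separated as [d0 [Hd0 Hsep]].
  set (h := delta / 5). assert (0 < h) as Hh by (unfold h; lra).
  destruct (INR_unbounded (D / (h / 2))) as [k Hk].
  apply Rlt_div_l in Hk; [|lra].
  assert (0 < 3 ^ k) as H3 by (apply pow_lt; lra).
  set (c1 := h / (48 * D) / 3 ^ k).
  assert (0 < c1) as Hc1 by (unfold c1; repeat apply Rdiv_lt_0_compat; lra).
  set (c := c1 / (40 * PI)).
  assert (0 < c) as Hc by (apply Rdiv_lt_0_compat; lra).
  (* chosen so that [c * ln (r / h) = 2 * PI + c] *)
  set (r := h * exp (2 * PI / c + 1)).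
  assert (h < r) as Hhr.
  { unfold r. rewrite <- (Rmult_1_r h) at 1. apply Rmult_lt_compat_l; [lra|].
    rewrite <- exp_0 at 1. apply exp_increasing.
    assert (0 < 2 * PI / c) as Hpc by (apply Rdiv_lt_0_compat; [lra | exact Hc]). lra. }
  destruct (INR_unbounded (r / d0)) as [N1 HN1]. apply Rlt_div_l in HN1; [|lra].
  destruct (INR_unbounded (r / D)) as [N2 HN2]. apply Rlt_div_l in HN2; [|lra].
  set (N := (N1 + N2 + 3)%nat).
  destruct (s_blocks N ltac:(unfold N; lia)) as [t [Hinc [Hblock [Hgap Hshort]]]].
  pose proof (chain_lt t N Hinc) as Hlt.
  assert (forall n, (1 <= n <= N)%nat -> exists m, s m = t n) as Hts.
  { intros n Hn. now destruct (proj2 (Hblock (t n))) as [_ Hm]; [exists n|]. }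
  assert (forall n, (1 <= n <= N)%nat -> Theta (RtoC (t n)) = RtoC 1) as Hone.
  { intros n Hn. apply Theta_spectrum. now apply Hts. }
  assert (forall n x, (1 <= n < N)%nat -> t n < x < t (S n) -> Theta (RtoC x) <> RtoC 1) as Hbetween.
  { intros n x Hn Hx HC. apply Theta_spectrum in HC.
    assert (t 1%nat <= t n) as B1 by (destruct (Nat.eq_dec n 1) as [->|]; [lra | left; apply Hlt; lia]).
    assert (t (S n) <= t N) as B2 by (destruct (Nat.eq_dec (S n) N) as [->|]; [lra | left; apply Hlt; lia]).
    destruct (proj1 (Hblock x)) as [j [Hj Ej]]; [split; [lra | exact HC]|]. subst x.
    destruct (le_lt_dec j n) as [Hjn|Hjn].
    - destruct (Nat.eq_dec j n) as [->|]; [lra|]. pose proof (Hlt j n ltac:(lia) ltac:(lia)). lra.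
    - destruct (Nat.eq_dec j (S n)) as [->|]; [lra|]. pose proof (Hlt (S n) j ltac:(lia) ltac:(lia)). lra. }
  assert (r <= t N - t 2%nat) as Hlen.
  { pose proof (chain_growth t 2 (N - 2) d0) as G.
    replace (2 + (N - 2))%nat with N in G by (unfold N; lia).
    assert (t 2%nat + INR (N - 2) * d0 <= t N) as G'.
    { apply G. intros n Hn. destruct (Hts n ltac:(lia)) as [m Em].
      destruct (Hts (S n) ltac:(lia)) as [m' Em'].
      pose proof (Hinc n ltac:(lia)) as Hn'.
      assert (m <> m') as Hmm by (intros ->; lra).
      specialize (Hsep m m' Hmm). rewrite Em, Em', Rabs_left in Hsep by lra. lra. }
    assert (INR N1 <= INR (N - 2)) by (apply le_INR; unfold N; lia).
    assert (INR N1 * d0 <= INR (N - 2) * d0) by (apply Rmult_le_compat_r; lra). lra. }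
  assert (r < t 2%nat - t 1%nat) as Hgap'.
  { assert (INR N2 <= INR N) by (apply le_INR; unfold N; lia).
    assert (INR N2 * D <= INR N * D) by (apply Rmult_le_compat_r; lra). lra. }
  set (u := fun x y => - ln (Cmod (Theta (x, y)))).
  assert (forall x, t 2%nat <= x <= t N -> c1 <= u x h) as Hu.
  { intros x Hx.
    destruct (chain_locate t 2 N x ltac:(unfold N; lia) Hx) as [n [Hn Hxn]].
    specialize (Hshort n ltac:(lia)). specialize (Hinc n ltac:(lia)).
    destruct (short_interval Theta Hdr Hunit (t n) (t (S n))) as [xi [Hxi Hsp]].
    - intros y. now apply (speed_nonneg Theta delta).
    - exact Hinc.
    - apply Hone; lia.
    - apply Hone; lia.
    - intros y Hy. apply (Hbetween n); [lia | exact Hy].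
    - pose proof (speed_le_interior Theta delta Hd H1 Hunit Hnz xi h Hh ltac:(unfold h; lra)) as HS.
      pose proof (harnack_chain Theta delta Hd H1 Hunit Hnz h k Hh ltac:(unfold h; lra) xi x) as HC.
      assert (/ D <= / (t (S n) - t n)) as HD by (apply Rinv_le_contravar; lra).
      assert (u xi h <= 3 ^ k * u x h) as HC' by (apply HC, Rabs_le; lra).
      assert (h / (48 * D) <= u xi h) as HE.
      { assert (/ D <= 48 * u xi h / h) as HF.
        { eapply Rle_trans; [exact HD|]. eapply Rle_trans; [exact Hsp | exact HS]. }
        apply Rle_div_r in HF; [|lra].
        replace (h / (48 * D)) with (/ D * h / 48) by (field; lra). lra. }
      unfold c1. apply Rle_div_l; [lra|]. lra. }
  pose proof (gap_log Theta Hdr Hunit (t 2%nat - r) (t 2%nat - h) (t 2%nat) c) as HG.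
  assert (c * (ln (t 2%nat - (t 2%nat - r)) - ln (t 2%nat - (t 2%nat - h))) <= 2 * PI) as HGG.
  { apply HG; [lra | lra | |].
    - intros x Hx. apply (Hbetween 1%nat); [unfold N; lia | lra].
    - intros x Hx.
      pose proof (speed_beside_block Theta delta Hd H1 Hunit Hnz (t 2%nat) (t N) c1 h (t 2%nat - x)
        Hh ltac:(unfold h; lra) Hc1 Hu ltac:(lra)) as HB.
      replace (t 2%nat - (t 2%nat - x)) with x in HB by ring. exact HB. }
  replace (t 2%nat - (t 2%nat - r)) with r in HGG by ring.
  replace (t 2%nat - (t 2%nat - h)) with h in HGG by ring.
  unfold r in HGG. rewrite ln_mult, ln_exp in HGG by (lra || apply exp_pos).
  clearbody c. replace (c * (ln h + (2 * PI / c + 1) - ln h)) with (2 * PI + c) in HGG by (field; lra).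
  lra.
Qed.

(** By [schwarz_pick], [|f|] is at most [(y - e) / (y + e) <= 1 - e / y] at the
    height [e] above [x]. *)
Lemma speed_ge_inv_height (f : C -> C) (x y : R) :
  (forall z, 0 <= Im z -> ex_Cderive f z /\ Cmod (f z) <= 1) ->
  (forall t : R, Cmod (f (RtoC t)) = 1) ->
  0 < y -> f (x, y) = RtoC 0 -> / y <= speed f x.
Proof.
  intros Hf Hunit Hy H0.
  apply (speed_ge f (fun t => proj1 (Hf (RtoC t) ltac:(cbn; lra))) Hunit x (/ y) y Hy).
  intros e He.
  pose proof (schwarz_pick f (x, y) Hf Hy H0 (x, e) ltac:(cbn; lra)) as H.
  replace (Cconj (x, y)) with ((x, - y) : C) in H by reflexivity.
  rewrite !Cmod_vertical, Rabs_right, Rabs_left in H by lra.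
  apply Rmult_le_reg_r with (e - - y); [lra|].
  eapply Rle_trans; [exact H|].
  replace ((1 - / y * e) * (e - - y)) with (y - e * e / y) by (field; lra).
  assert (e * e / y <= e); [|lra]. apply Rle_div_l; [lra|]. nra.
Qed.

Theorem proposition2 (s : nat -> R) (D : R) (Theta : C -> C)
  (s_separated : separated s)
  (D_pos : 0 < D)
  (s_blocks : forall N : nat, (2 <= N)%nat ->
    exists t : nat -> R,
      (forall n : nat, (1 <= n < N)%nat -> t n < t (S n)) /\
      (forall x : R,
         (t 1%nat <= x <= t N /\ exists m : nat, s m = x) <->
         (exists n : nat, (1 <= n <= N)%nat /\ t n = x)) /\
      t 2%nat - t 1%nat > INR N * D /\
      (forall n : nat, (2 <= n <= N - 1)%nat -> t (S n) - t n < D))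
  (Theta_mif : meromorphic_inner_function Theta)
  (Theta_spectrum : forall x : R, spectrum Theta x <-> exists n : nat, s n = x) :
  (forall delta : R, 0 < delta ->
     exists x y : R, Theta (x, y) = RtoC 0 /\ 0 < y < delta) /\
  (forall M : R, exists (x : R) (l : C),
     is_derive (K := C_AbsRing) Theta (RtoC x) l /\ M < Cmod l).
Proof.
  pose proof (fun delta => zeros_near_line s D Theta delta s_separated D_pos s_blocks Theta_mif Theta_spectrum)
    as Hzeros.
  split; [exact Hzeros|].
  intros M.
  assert (forall z, 0 <= Im z -> ex_Cderive Theta z /\ Cmod (Theta z) <= 1) as Hf.
  { intros z Hz. split; [now apply mif_derivable | now apply mif_le_1]. }
  pose proof (fun x => mif_unimodular Theta x Theta_mif) as Hunit.
  pose proof (fun x => proj1 (Hf (RtoC x) ltac:(cbn; lra))) as Hdr.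
  pose proof (Rabs_pos M) as HM. pose proof (Rle_abs M) as HM'.
  destruct (Hzeros (/ (Rabs M + 1))) as (x & y & Hz & Hy); [apply Rinv_0_lt_compat; lra|].
  exists x, (C_derive Theta (RtoC x)). split.
  - exact (C_derive_correct Theta (RtoC x) (RtoC 0) (Hdr x)).
  - rewrite (Cmod_derive Theta Hdr Hunit).
    pose proof (speed_ge_inv_height Theta x y Hf Hunit ltac:(lra) Hz) as HS.
    pose proof (Rle_abs (speed Theta x)).
    assert (Rabs M + 1 < / y); [|lra].
    rewrite <- (Rinv_inv (Rabs M + 1)). apply Rinv_lt_contravar; [|lra].
    apply Rmult_lt_0_compat; lra.
Qed.
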